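(* Suppose that the nested fractal $\mathcal K$ satisfies Property (P). Then there is a constant $C>0$ depending only on $\mathcal K$ such that for every $f\in\mathcal D(\mathcal E)$ and all $x,y\in\mathcal K\setminus V^{(\infty)}$ with $x\ne y$, $$|f(x)-f(y)|^2\le C\,\rho(x,y)^{d_w}\,\frac{1}{\mu(S(x,y))}\int_{S(x,y)}\langle\nabla f,Z\,\nabla f\rangle\,d\nu .$$
   Context: Nested fractal. Let $\phi_1,\dots,\phi_M$ ($M\ge2$) be similitudes of $\mathbb R^N$ with common scaling factor $L>1$, i.e. $|\phi_i(x)-\phi_i(y)|=L^{-1}|x-y|$. For $A\subset\mathbb R^N$ put $\Phi(A)=\bigcup_{i=1}^M\phi_i(A)$, and let $\Phi^m$ be its $m$-fold iterate. $\mathcal K$ is the unique nonempty compact set with $\mathcal K=\Phi(\mathcal K)$; it is normalized so that $\mathrm{diam}\,\mathcal K=1$. Let $v_i$ be the fixed point of $\phi_i$; $v_i$ is essential if there are another fixed point $v_j\ne v_i$ and $k,l$ with $\phi_k(v_i)=\phi_l(v_j)$. $V^{(0)}$ is the set of essential fixed points, $r=\#V^{(0)}\ge2$, $V^{(m)}=\Phi^m(V^{(0)})$, $V^{(\infty)}=\bigcup_{m\ge0}V^{(m)}$. $\mathcal W_m=\{1,\dots,M\}^m$; for $w=(w_1,\dots,w_m)\in\mathcal W_m$, $\phi_w=\phi_{w_1}\circ\cdots\circ\phi_{w_m}$ and $\mathcal K_w=\phi_w(\mathcal K)$. The sets $\mathcal K_w$, $w\in\mathcal W_m$, are the $m$-simplices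 (the $0$-simplex is $\mathcal K$), $\mathcal T_m$ is their collection, and $V(\mathcal K_w)=\phi_w(V^{(0)})$. $\mathcal K$ is a nested fractal, meaning: (open set condition) there is a nonempty open $U$ with $\Phi(U)\subset U$ and $\phi_i(U)\cap\phi_j(U)=\emptyset$ for $i\ne j$; (nesting) $S\cap T=V(S)\cap V(T)$ for distinct $S,T\in\mathcal T_m$, $m\ge1$; (connectivity) the graph on $V^{(1)}$ joining points of a common $\phi_i(V^{(0)})$ is connected; (symmetry) for $x\neq y$ in $V^{(0)}$, the reflection $R_{x,y}$ in the hyperplane bisecting $[x,y]$ maps each $\phi_i(V^{(0)})$ onto some $\phi_j(V^{(0)})$. $d=\log M/\log L$ is the Hausdorff dimension of $\mathcal K$, and $\mu$ is the $d$-dimensional Hausdorff measure on $\mathcal K$ normalized by $\mu(\mathcal K)=1$. $\rho(x,y)$ is the Euclidean distance. Simplices. For $x\in\mathcal K\setminus V^{(\infty)}$, $\Delta_m(x)$ is the unique $m$-simplex containing $x$. For $\Delta\in\mathcal T_m$, $\Delta^*$ is the union of $\Delta$ and all $m$-simplices adjacent to (i.e. intersecting) $\Delta$; $\Delta_m^*(x)=(\Delta_m(x))^*$. For distinct $x,y\in\mathcal K\setminus V^{(\infty)}$, $\mathrm{ind}(x,y)=\min\{m\ge1:\Delta_m(x)\cap\Delta_m(y)=\emptyset\}$, and if $\mathrm{ind}(x,y)=n$ then $S(x,y)=\Delta_{n-1}(x)\cup\Delta_{n-1}(y)$. Property (P): there exists $\alpha>0$ such that for all $n=1,2,\dots$ and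 all $x,y\in\mathcal K\setminus V^{(\infty)}$ with $y\in\Delta_n^*(x)\setminus\Delta_{n+1}^*(x)$ one has $\rho(x,y)\ge\alpha L^{-n}$. Harmonic structure and Dirichlet form. A conductivity matrix is a symmetric real $A=[a_{x,y}]_{x,y\in V^{(0)}}$ with nonnegative off-diagonal entries and zero row sums; $\mathcal E^{(0)}_A(f,f)=\frac12\sum_{x,y}a_{x,y}(f(x)-f(y))^2$. It is known that there are a unique number $\varrho>1$ and a unique, up to a multiplicative constant, irreducible $A$ invariant under the group generated by the $R_{x,y}$, $x\ne y\in V^{(0)}$, such that for all $f:V^{(0)}\to\mathbb R$, $\inf\{\sum_{i=1}^M\mathcal E^{(0)}_A(g\circ\phi_i,g\circ\phi_i): g:V^{(1)}\to\mathbb R,\ g|_{V^{(0)}}=f\}=\varrho^{-1}\mathcal E^{(0)}_A(f,f)$. Fix such $A$, write $\mathcal E^{(0)}=\mathcal E^{(0)}_A$. The walk dimension is $d_w=\log(M\varrho)/\log L$, so $\varrho=L^{d_w-d}$. For $f\in C(\mathcal K)$, $\mathcal E^{(m)}(f,f)=\varrho^m\sum_{w\in\mathcal W_m}\mathcal E^{(0)}(f\circ\phi_w,f\circ\phi_w)$ is nondecreasing in $m$; $\mathcal D(\mathcal E)=\{f\in C(\mathcal K):\sup_m\mathcal E^{(m)}(f,f)<\infty\}$ and $\mathcal E(f,f)=\lim_m\mathcal E^{(m)}(f,f)$. Kusuoka measure and gradient. For $f:V^{(0)}\to\mathbb R$ (or $f\in C(\mathcal K)$, restricted to $V^{(0)}$),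 $Hf$ is the unique minimizer of $\mathcal E(g,g)$ among $g\in\mathcal D(\mathcal E)$ with $g=f$ on $V^{(0)}$; such functions are called harmonic. $\mathcal H$ is the space of harmonic functions with norm $\|h\|_{\mathcal H}^2=\mathcal E(h,h)+(\sum_{x\in V^{(0)}}h(x))^2$; $\widetilde{\mathcal H}$ is the orthogonal complement of the constants in $\mathcal H$, with norm $\|h\|^2=\mathcal E(h,h)$ and scalar product $\langle\cdot,\cdot\rangle$; $\widetilde P:\mathcal H\to\widetilde{\mathcal H}$ is the orthogonal projection. $\widetilde M_ih=\widetilde P(h\circ\phi_i)$ for $h\in\widetilde{\mathcal H}$, and $\widetilde M_w=\widetilde M_{w_m}\circ\cdots\circ\widetilde M_{w_1}$. The harmonic structure is assumed nondegenerate: all $\widetilde M_i$ are invertible. The Kusuoka measure $\nu$ is the Borel measure on $\mathcal K$ (without atoms) with $\nu(\mathcal K_w)=\varrho^m\,\mathrm{Tr}(\widetilde M_w^*\widetilde M_w)$, $w\in\mathcal W_m$. For $x\in\mathcal K\setminus V^{(\infty)}$ with unique address $w=w_1w_2\cdots$ and $[w]_m=(w_1,\dots,w_m)$, put $Z_m(x)=\widetilde M_{[w]_m}^*\widetilde M_{[w]_m}/\mathrm{Tr}(\widetilde M_{[w]_m}^*\widetilde M_{[w]_m})$; then $Z=\lim_mZ_m$ exists $\nu$-a.e. Put $\nabla_mf(x)=\widetilde M_{[w]_m}^{-1}\widetilde PH(f\circ\phi_{[w]_m})\in\widetilde{\mathcal H}$. For $f\in\mathcal D(\mathcal E)$, $\nabla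 f:\mathcal K\to\widetilde{\mathcal H}$ denotes a measurable map, defined $\nu$-a.e., which is the limit of $\nabla_mf$ in the seminorm $F\mapsto(\int_{\mathcal K}\langle F,ZF\rangle\,d\nu)^{1/2}$; it satisfies $\mathcal E(f,f)=\int_{\mathcal K}\langle\nabla f,Z\nabla f\rangle\,d\nu$ (the function $\langle\nabla f,Z\nabla f\rangle$ is determined $\nu$-a.e.). *)

(* Defs.v *)
From Stdlib Require Import Relation_Operators.
From HB Require Import structures.
From mathcomp Require Import all_boot all_order all_algebra.
From mathcomp Require Import all_classical all_reals all_analysis.

Set Implicit Arguments.
Unset Strict Implicit.
Unset Printing Implicit Defensive.

Import Order.TTheory GRing.Theory Num.Theory.
Import numFieldNormedType.Exports.

Local Open Scope classical_set_scope.
Local Open Scope ring_scope.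

(* Borel sigma-algebra of R^N. *)
Notation borelE R N := (g_sigma_algebraType (@open 'rV[R]_N)).

(* The library's norm on ['rV[R]_N] is the sup norm, so the Euclidean structure
   is spelled out; the two induce the same topology. *)
Section Euclidean.
Context {R : realType} {N : nat}.
Local Notation E := 'rV[R]_N.
Implicit Types (x y z : E) (A V : set E).

Definition dot x y : R := \sum_k x 0 k * y 0 k.

Definition eucl_dist x y : R := Num.sqrt (dot (x - y) (x - y)).

(* The [maxe 0] only matters for the empty set, whose diameter is 0. *)
Definition diam A : \bar R :=
  maxe 0%E (ereal_sup [set (eucl_dist p.1 p.2)%:E | p in A `*` A]).

(* Reflection in the hyperplane bisecting the segment [x, y]. *)
Definition reflect_pt x y z : E :=
  z - (2 * dot (z - 2^-1 *: (x + y)) (x - y) / dot (x - y) (x - y)) *: (x - y).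

(* Reflections are involutions, so closing under composition gives a group. *)
Inductive reflection_group V : (E -> E) -> Prop :=
| refl_group_id : reflection_group V id
| refl_group_comp x y g : V x -> V y -> x <> y -> reflection_group V g ->
    reflection_group V (reflect_pt x y \o g).

Local Open Scope ereal_scope.

Definition hausdorff_pre (d delta : R) A : \bar R :=
  ereal_inf [set \sum_(0 <= k <oo) (diam (U k)) `^ d | U in
    [set U : nat -> set E | A `<=` \bigcup_k U k /\
                            forall k, diam (U k) <= delta%:E]].

Definition hausdorff (d : R) A : \bar R :=
  ereal_sup [set hausdorff_pre d delta A | delta in [set x : R | (0 < x)%R]].

End Euclidean.

Section Geometry.
Context {R : realType} {N M : nat}.
Local Notation E := 'rV[R]_N.
Variables (phi : 'I_M -> E -> E) (L : R) (K : set E).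

Definition Phi (A : set E) : set E := \bigcup_i (phi i @` A).

Definition essential : set E :=
  [set v | exists i j w, [/\ phi i v = v, phi j w = w, w <> v &
                             exists k l, phi k v = phi l w]].

Definition Vm (m : nat) : set E := iter m Phi essential.
Definition Vinf : set E := \bigcup_m Vm m.

(* [phi_w [:: i1; ...; im]] is phi i1 \o ... \o phi im. *)
Definition phi_w (w : seq 'I_M) : E -> E := foldr (fun i g => phi i \o g) id w.

Definition cell (w : seq 'I_M) : set E := phi_w w @` K.
Definition cell_vertices (w : seq 'I_M) : set E := phi_w w @` essential.

Definition simplices (m : nat) : set (set E) :=
  [set cell w | w in [set w | size w = m]].

Record nested_fractal : Prop := NestedFractal {
  nf_M : (2 <= M)%N;
  nf_L : 1 < L;
  nf_similitude : forall i x y, eucl_dist (phi i x) (phi i y) = L^-1 * eucl_dist x y;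
  nf_nonempty : K !=set0;
  nf_compact : compact K;
  nf_selfsimilar : K = Phi K;
  nf_diam : diam K = 1%E;
  nf_r : exists x y, [/\ essential x, essential y & x <> y];
  nf_open_set : exists U : set E, [/\ open U, U !=set0, Phi U `<=` U &
    forall i j, i <> j -> phi i @` U `&` phi j @` U = set0];
  nf_nesting : forall m w w', (1 <= m)%N -> size w = m -> size w' = m ->
    cell w <> cell w' ->
    cell w `&` cell w' = cell_vertices w `&` cell_vertices w';
  nf_connected : forall x y, Vm 1 x -> Vm 1 y ->
    clos_refl_trans E (fun u v => exists i, (phi i @` essential) u /\
                                            (phi i @` essential) v) x y;
  nf_symmetry : forall x y, essential x -> essential y -> x <> y ->
    forall i, exists j,
      reflect_pt x y @` (phi i @` essential) = phi j @` essential
}.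

(* For x in K outside Vinf, the m-simplex containing x and its word are unique,
   so that [xget] does not involve any choice. *)
Definition Delta (m : nat) (x : E) : set E :=
  xget set0 [set S | simplices m S /\ S x].
Definition address (m : nat) (x : E) : seq 'I_M :=
  xget [::] [set w | size w = m /\ cell w x].

Definition star (m : nat) (S : set E) : set E :=
  S `|` \bigcup_(T in [set T | simplices m T /\ T `&` S !=set0]) T.

Definition separated_at (x y : E) (m : nat) : Prop :=
  (1 <= m)%N /\ Delta m x `&` Delta m y = set0.
Definition ind (x y : E) : nat :=
  xget 0%N [set m | separated_at x y m /\
                    forall k, separated_at x y k -> (m <= k)%N].
Definition Sxy (x y : E) : set E :=
  Delta (ind x y).-1 x `|` Delta (ind x y).-1 y.

Definition property_P : Prop :=
  exists2 alpha : R, 0 < alpha &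
    forall (n : nat) x y, (1 <= n)%N -> (K `\` Vinf) x -> (K `\` Vinf) y ->
      (star n (Delta n x) `\` star n.+1 (Delta n.+1 x)) y ->
      alpha * L ^- n <= eucl_dist x y.

End Geometry.

Section Dimensions.
Context {R : realType}.

Definition dim_hausdorff (M : nat) (L : R) : R := ln M%:R / ln L.

Definition walk_dim (M : nat) (L rho : R) : R := ln (M%:R * rho) / ln L.

Definition normalized_hausdorff {N} (d : R) (K : set 'rV[R]_N)
    (mu : {measure set (borelE R N) -> \bar R}) : Prop :=
  (exists c : R, forall A : set (borelE R N), measurable A ->
     mu A = (c%:E * hausdorff d (A `&` K))%E)
  /\ mu K = 1%E.

End Dimensions.

Section Analysis.
Context {R : realType} {N M : nat}.
Local Notation E := 'rV[R]_N.
Variables (phi : 'I_M -> E -> E) (K : set E).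
(* [a] is a matrix indexed by the essential fixed points; its other values are
   irrelevant. *)
Variables (a : E -> E -> R) (rho : R).
Local Notation V0 := (essential phi).
Implicit Types (f g h : E -> R) (w : seq 'I_M).

Definition energy0 f g : R :=
  2^-1 * \sum_(x \in V0) \sum_(y \in V0) a x y * (f x - f y) * (g x - g y).

Record conductivity_matrix : Prop := ConductivityMatrix {
  cm_sym : forall x y, V0 x -> V0 y -> a x y = a y x;
  cm_ge0 : forall x y, V0 x -> V0 y -> x <> y -> 0 <= a x y;
  cm_row : forall x, V0 x -> \sum_(y \in V0) a x y = 0
}.

Definition irreducible_matrix : Prop := forall x y, V0 x -> V0 y ->
  clos_refl_trans E (fun u v => [/\ V0 u, V0 v, u <> v & 0 < a u v]) x y.

Record harmonic_structure : Prop := HarmonicStructure {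
  hs_conductivity : conductivity_matrix;
  hs_irreducible : irreducible_matrix;
  hs_invariant : forall s, reflection_group V0 s ->
    forall x y, V0 x -> V0 y -> a (s x) (s y) = a x y;
  hs_rho : 1 < rho;
  hs_renormalization : forall f,
    inf [set \sum_(i < M) energy0 (g \o phi i) (g \o phi i) | g in
          [set g | forall x, V0 x -> g x = f x]] = rho^-1 * energy0 f f
}.

Definition energym (m : nat) f g : R :=
  rho ^+ m * \sum_(w : m.-tuple 'I_M) energy0 (f \o phi_w phi w) (g \o phi_w phi w).

(* A function on K is represented by any function on R^N extending it. *)
Definition energy_domain : set (E -> R) :=
  [set f | {within K, continuous f} /\
           has_ubound (range (fun m => energym m f f))].

(* Polarized form; on the diagonal it is the limit of the E^(m)(f, f). *)
Definition energy f g : R := limn (fun m => energym m f g).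

(* Harmonic functions on K are extended by 0, so that they can be compared by
   equality. *)
Definition harmonic_extension f : set (E -> R) :=
  [set h | [/\ energy_domain h, forall x, V0 x -> h x = f x,
               forall x, ~ K x -> h x = 0 &
               forall g, energy_domain g -> (forall x, V0 x -> g x = f x) ->
                         energy h h <= energy g g]].
Definition Hext f : E -> R := xget (cst 0) (harmonic_extension f).

Definition harmonic_fun : set (E -> R) := [set h | harmonic_extension h h].

(* Scalar product of the norm E(h, h) + (sum of h over V0)^2. *)
Definition dotH f g : R :=
  energy f g + (\sum_(x \in V0) f x) * (\sum_(x \in V0) g x).

Definition oneK : E -> R := \1_K.

Definition Htilde : set (E -> R) := [set h | harmonic_fun h /\ dotH h oneK = 0].

(* Orthogonal projection along the constants; [patch] restricts to K. *)
Definition Ptilde f : E -> R :=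
  let h := patch (cst 0) K f in
  fun x => h x - dotH h oneK / dotH oneK oneK * oneK x.

Definition Mtilde (i : 'I_M) h : E -> R := Ptilde (h \o phi i).

(* The first letter acts first: Mtilde_w = Mtilde_(wm) \o ... \o Mtilde_(w1). *)
Definition Mtilde_w w h : E -> R := foldl (fun g i => Mtilde i g) h w.

Definition nondegenerate_structure : Prop :=
  forall i, set_bij Htilde Htilde (Mtilde i).

Definition orthonormal_basis n (e : 'I_n -> E -> R) : Prop :=
  [/\ forall k, Htilde (e k),
      forall k l, energy (e k) (e l) = (k == l)%:R &
      forall h, Htilde h ->
        exists c : 'I_n -> R, forall x, h x = \sum_k c k * e k x].

(* Through an orthonormal basis [e], Htilde is identified with R^n, its
   operators with matrices, and adjoints with transposes. *)
Section Coordinates.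
Context {n : nat} (e : 'I_n -> E -> R).

Definition coordH h : 'cV[R]_n := \col_k energy (e k) h.

Definition Mmx w : 'M[R]_n := \matrix_(k, l) energy (e k) (Mtilde_w w (e l)).

Definition kusuoka_measure (nu : {measure set (borelE R N) -> \bar R}) : Prop :=
  [/\ nu (~` K) = 0%E,
      forall x : E, nu [set x] = 0%E &
      forall w, nu (cell phi K w) =
                (rho ^+ size w * \tr ((Mmx w)^T *m Mmx w))%:E].

Definition Zm (m : nat) (x : E) : 'M[R]_n :=
  let A := Mmx (address phi K m x) in (\tr (A^T *m A))^-1 *: (A^T *m A).

Definition is_Z (nu : {measure set (borelE R N) -> \bar R})
    (Z : borelE R N -> 'M[R]_n) : Prop :=
  (forall k l, measurable_fun (K : set (borelE R N)) (fun x => Z x k l)) /\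
  {ae nu, forall x, K x -> (fun m => Zm m x) @ \oo --> Z x}.

(* <F, Z F> *)
Definition qform (Z : 'M[R]_n) (F : 'cV[R]_n) : R := (F^T *m Z *m F) 0 0.

Definition Zseminorm (nu : {measure set (borelE R N) -> \bar R})
    (Z : borelE R N -> 'M[R]_n) (F : borelE R N -> 'cV[R]_n) : \bar R :=
  sqrte (\int[nu]_(x in K) (qform (Z x) (F x))%:E)%E.

Definition nabla_m (m : nat) f (x : E) : 'cV[R]_n :=
  let w := address phi K m x in
  invmx (Mmx w) *m coordH (Ptilde (Hext (f \o phi_w phi w))).

Definition is_gradient (nu : {measure set (borelE R N) -> \bar R})
    (Z : borelE R N -> 'M[R]_n) f (gradf : borelE R N -> 'cV[R]_n) : Prop :=
  (forall k, measurable_fun (K : set (borelE R N)) (fun x => gradf x k 0)) /\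
  (fun m => Zseminorm nu Z (fun x => nabla_m m f x - gradf x)) @ \oo --> 0%E.

End Coordinates.

End Analysis.

(* Main.v *)
From Stdlib Require Import Relation_Operators.
Require Import Defs.
From mathcomp Require Import all_boot all_order all_algebra.
From mathcomp Require Import finmap.
From mathcomp Require Import all_classical all_reals all_analysis.
From mathcomp Require Import measurable_realfun.
From mathcomp Require Import ring lra zify.

Set Implicit Arguments.
Unset Strict Implicit.
Unset Printing Implicit Defensive.

Import Order.TTheory GRing.Theory Num.Theory.
Import numFieldNormedType.Exports.
Local Open Scope classical_set_scope.
Local Open Scope ring_scope.

(** Let [m + 1] be the separation level of [x] and [y]. Below that level the two
    points lie in cells [phi_w w @` K] and [phi_w w' @` K] of level [m] that share
    a point [z] ([ind_pred_cells]), so it is enough to control the increments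
    [f x - f z] and [f z - f y], each of which lives in a single cell.

    On the whole of [K] the squared oscillation of a function of finite energy is
    at most a constant times its energy ([oscillation_bound]): along the cells
    shrinking to a point, increments decay geometrically because [rho > 1].
    Applied to [f \o phi_w w], this bounds the increment in a cell by
    [energy (f \o phi_w w)].

    The energy in a cell is paid for by the gradient:
    [rho ^ m * energy (f \o phi_w w)] is at most the integral of
    [<gradf, Z gradf>] over the cell ([integral_gradient_ge]). Two facts give
    this. First, in an orthonormal basis of harmonic functions the
    self-similarity of the energy says that
    [rho * \sum_i Mmx [i]^T Mmx [i] = 1]; the matrices [Zm m] therefore have the
    same integral over a given cell for all large [m], and by dominated
    convergence so does [Z] ([integral_Z]). Second, [nabla_m] is constant on the
    cells of level [m] and is built to cancel the matrix of the cell, so that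
    its integral becomes a sum of energies of harmonic extensions, at least
    [energym] ([integral_nabla_ge]). The passage from [nabla_m] to [gradf] is
    continuity for the seminorm given by [Z]. Harmonic extensions have to be
    known to exist for this; they are obtained by minimizing the energy, the
    oscillation bound turning convergence in energy into uniform convergence
    ([harmonic_extension_exists]).

    It remains to compare scales. The cover of [K] by its [M ^ m] cells shows that
    each has mass [M ^- m], and incidentally that different words of the same
    length have different cells ([mu_cover_ge]). Property (P) bounds the distance
    of [x] and [y] below by a multiple of [L ^- m] ([separated_dist]). Since
    [L `^ walk_dim = M * rho], the quotient of [eucl_dist x y `^ walk_dim] by the
    mass is at least a multiple of [rho ^- m], which is the factor lost in the
    gradient estimate ([dist_volume_bound]). *)

(** * Euclidean distance *)

Section EuclideanDistance.
Context {R : realType} {N : nat}.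
Implicit Types x y : 'rV[R]_N.

Lemma eucl_dist_ge0 x y : 0 <= eucl_dist x y.
Proof. exact: sqrtr_ge0. Qed.

Lemma coord_le_eucl_dist x y k : `|x 0 k - y 0 k| <= eucl_dist x y.
Proof.
rewrite -sqrtr_sqr /eucl_dist ler_wsqrtr // /dot (bigD1 k) //= !mxE -expr2 lerDl.
by apply: sumr_ge0 => l _; rewrite -expr2 sqr_ge0.
Qed.

Lemma eucl_dist_eq0 x y : eucl_dist x y <= 0 -> x = y.
Proof.
move=> h; apply/rowP => k; apply/eqP; rewrite -subr_eq0 -normr_le0.
exact: le_trans (coord_le_eucl_dist _ _ _) h.
Qed.

Lemma eucl_dist_gt0 x y : x <> y -> 0 < eucl_dist x y.
Proof.
move=> xy; rewrite lt_neqAle eucl_dist_ge0 andbT eq_sym.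
by apply/eqP => h; apply/xy/eucl_dist_eq0; rewrite h.
Qed.

Lemma eucl_distxx x : eucl_dist x x = 0.
Proof.
rewrite /eucl_dist subrr /dot big1 ?sqrtr0 // => k _.
by rewrite mxE mul0r.
Qed.

Lemma eucl_dist_ball x y (e : R) : 0 < e -> eucl_dist x y < e -> ball x e y.
Proof.
move=> e0 h; split=> // i j; rewrite ord1.
exact: le_lt_trans (coord_le_eucl_dist _ _ _) h.
Qed.

Lemma eucl_dist_continuous :
  continuous (fun p : 'rV[R]_N * 'rV[R]_N => eucl_dist p.1 p.2).
Proof.
move=> p; apply: (@continuous_comp _ _ _
  (fun p : 'rV[R]_N * 'rV[R]_N => dot (p.1 - p.2) (p.1 - p.2)) (@Num.sqrt R));
  last exact: sqrt_continuous.
apply: cvg_big => [|k _]; first exact: add_continuous.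
have c : (fun q : 'rV[R]_N * 'rV[R]_N => (q.1 - q.2) 0 k) @ p --> (p.1 - p.2) 0 k.
  have -> : (fun q : 'rV[R]_N * 'rV[R]_N => (q.1 - q.2) 0 k) =
            (fun q => q.1 0 k - q.2 0 k).
    by apply/funext => q; rewrite !mxE.
  rewrite !mxE; apply: cvgB.
    by apply: (@continuous_comp _ _ _ fst (fun v : 'rV[R]_N => v 0 k));
      [exact: cvg_fst|exact: coord_continuous].
  by apply: (@continuous_comp _ _ _ snd (fun v : 'rV[R]_N => v 0 k));
      [exact: cvg_snd|exact: coord_continuous].
exact: cvgM.
Qed.

Lemma near_eucl_dist x (e : R) : 0 < e -> \forall y \near x, eucl_dist x y < e.
Proof.
move=> e0; have : eucl_dist x y @[y --> x] --> eucl_dist x x.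
  apply: (@continuous_comp _ _ _ (fun y => (x, y)) (fun p => eucl_dist p.1 p.2) x).
    move=> /= P.
    apply: (@cvg_pair _ _ _ (nbhs x) (nbhs x) (nbhs x) _ _ _ (cst x) id);
      [exact: cvg_cst|exact: cvg_id].
  exact: eucl_dist_continuous.
rewrite eucl_distxx => /cvgr_lt/(_ _ e0); exact.
Qed.

Lemma compact_disjoint_dist (A B : set 'rV[R]_N) :
  compact A -> compact B -> A `&` B = set0 ->
  exists2 d : R, 0 < d & forall x y, A x -> B y -> d <= eucl_dist x y.
Proof.
move=> cA cB AB.
have [[p ABp]|e] := pselect (A `*` B !=set0); last first.
  exists 1 => // x y Ax By; exfalso; apply: e; by exists (x, y).
have AB0 : A `*` B !=set0 by exists p.
have cf : {within A `*` B, continuous (fun p => eucl_dist p.1 p.2)}.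
  exact/continuous_subspaceT/eucl_dist_continuous.
have [[u v] uvAB mn] := compact_EVT_min AB0 (compact_setX cA cB) cf.
have [/= Au Bv] : (A `*` B) (u, v) := set_mem uvAB.
exists (eucl_dist u v).
  apply: eucl_dist_gt0 => uv; have : (A `&` B) u by split=> //; rewrite uv.
  by rewrite AB.
move=> x y Ax By; exact: (mn (x, y) (mem_set _)).
Qed.

End EuclideanDistance.

(** * Cells of a nested fractal *)

Lemma exists_expr_lt {R : realType} (q e : R) :
  0 <= q < 1 -> 0 < e -> exists n, q ^+ n < e.
Proof.
move=> /andP[q0 q1] e0.
have /cvg_expr : `|q| < 1 by rewrite ger0_norm.
by move=> /cvgr_lt/(_ _ e0)[n _ /(_ n (leqnn n))] h; exists n.
Qed.

Section NestedFractal.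
Context {R : realType} {N M : nat}.
Context (phi : 'I_M -> 'rV[R]_N -> 'rV[R]_N) (L : R) (K : set 'rV[R]_N).
Context (nf : nested_fractal phi L K).
Local Notation E := 'rV[R]_N.
Local Notation V0 := (essential phi).
Implicit Types (x y z : E) (w u : seq 'I_M).

Lemma ratio_gt0 : 0 < L^-1.
Proof. by rewrite invr_gt0 (lt_trans ltr01) ?(nf_L nf). Qed.

Lemma ratio_lt1 : L^-1 < 1.
Proof. by rewrite invf_lt1 ?(nf_L nf) // (lt_trans ltr01) ?(nf_L nf). Qed.

Lemma exists_ratio_lt (e : R) : 0 < e -> exists n, L^-1 ^+ n < e.
Proof. by apply: exists_expr_lt; rewrite ratio_lt1 ltW ?ratio_gt0. Qed.

Lemma phi_w_cat w u : phi_w phi (w ++ u) = phi_w phi w \o phi_w phi u.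
Proof. by elim: w => //= i w ->. Qed.

Lemma phi_w_rcons w i : phi_w phi (rcons w i) = phi_w phi w \o phi i.
Proof. by rewrite -cats1 phi_w_cat. Qed.

Lemma phi_w_dist w x y :
  eucl_dist (phi_w phi w x) (phi_w phi w y) = L^-1 ^+ size w * eucl_dist x y.
Proof.
by elim: w => [|i w IH] /=; rewrite ?expr0 ?mul1r // (nf_similitude nf) IH exprS mulrA.
Qed.

Lemma phi_continuous i : continuous (phi i).
Proof.
move=> x A /nbhs_ballP[e /= e0 eA].
have := near_eucl_dist x e0; apply: filterS => y xy.
apply/eA/eucl_dist_ball => //.
rewrite (nf_similitude nf) (le_lt_trans _ xy) //.
by rewrite ler_piMl ?eucl_dist_ge0 // ltW ?ratio_lt1.
Qed.

Lemma phi_w_continuous w : continuous (phi_w phi w).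
Proof.
elim: w => [|i w IH] /= x; first exact: cvg_id.
by apply: continuous_comp; [exact: IH|exact: phi_continuous].
Qed.

Lemma K_dist x y : K x -> K y -> eucl_dist x y <= 1.
Proof.
move=> Kx Ky; rewrite -lee_fin -(nf_diam nf) /diam le_max; apply/orP; right.
by apply: ereal_sup_ubound; exists (x, y).
Qed.

Lemma phi_K i x : K x -> K (phi i x).
Proof. by move=> Kx; rewrite (nf_selfsimilar nf); exists i => //; exists x. Qed.

Lemma phi_w_K w x : K x -> K (phi_w phi w x).
Proof. by move=> Kx; elim: w => //= i w; exact: phi_K. Qed.

Lemma K_phi x : K x -> exists i y, K y /\ x = phi i y.
Proof. by rewrite {1}(nf_selfsimilar nf) => -[i _ [y Ky <-]]; exists i, y. Qed.

Lemma cell_sub w : cell phi K w `<=` K.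
Proof. by move=> _ [x Kx <-]; exact: phi_w_K. Qed.

Lemma cell_rcons w i : cell phi K (rcons w i) `<=` cell phi K w.
Proof.
by move=> _ [x Kx <-]; rewrite phi_w_rcons; exists (phi i x) => //; exact: phi_K.
Qed.

Lemma cell_split w x : cell phi K w x -> exists i, cell phi K (rcons w i) x.
Proof.
move=> [y /K_phi[i [z [Kz ->]]] <-]; exists i; exists z => //.
by rewrite phi_w_rcons.
Qed.

Lemma cell_exists m x : K x -> exists2 w, size w = m & cell phi K w x.
Proof.
move=> Kx; elim: m => [|m [w sw /cell_split[i ci]]].
  by exists [::] => //; exists x.
by exists (rcons w i) => //; rewrite size_rcons sw.
Qed.

Lemma cell_dist w x y :
  cell phi K w x -> cell phi K w y -> eucl_dist x y <= L^-1 ^+ size w.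
Proof.
move=> [x' Kx <-] [y' Ky <-]; rewrite phi_w_dist ler_piMr ?K_dist //.
by rewrite exprn_ge0 // ltW ?ratio_gt0.
Qed.

Lemma K_closed : closed K.
Proof. by apply: compact_closed; [exact: norm_hausdorff|exact: nf_compact nf]. Qed.

Lemma cell_compact w : compact (cell phi K w).
Proof.
apply: continuous_compact; last exact: nf_compact nf.
exact/continuous_subspaceT/phi_w_continuous.
Qed.

Lemma cell_closed w : closed (cell phi K w).
Proof. by apply: compact_closed; [exact: norm_hausdorff|exact: cell_compact]. Qed.

(** The topology of the ambient space comes from the sup norm; this is how
    estimates for the Euclidean distance reach it. *)
Lemma closed_eucl_dist (A : set E) x : closed A ->
  (forall e : R, 0 < e -> exists2 z, A z & eucl_dist x z < e) -> A x.
Proof.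
move=> cA h; apply: cA => B /nbhs_ballP[e /= e0 eB].
by have [z Az xz] := h _ e0; exists z; split=> //; apply/eB/eucl_dist_ball.
Qed.

Lemma essential_fixed x : V0 x -> exists i, phi i x = x.
Proof. by move=> [i [_ [_ [h _ _ _]]]]; exists i. Qed.

Lemma fixed_point_unique i x y : phi i x = x -> phi i y = y -> x = y.
Proof.
move=> hx hy; apply: eucl_dist_eq0; have := nf_similitude nf i x y.
rewrite hx hy => h; rewrite leNgt; apply/negP => d0.
by have := ratio_lt1; rewrite -(gtr_pMl _ d0) -h ltxx.
Qed.

(** The fixed point of [phi i] attracts the orbit of any point of [K]. *)
Lemma essential_K : V0 `<=` K.
Proof.
move=> v /essential_fixed[i hi]; have [x Kx] := nf_nonempty nf.
apply: closed_eucl_dist => [|e e0]; first exact: K_closed.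
have d0 : 0 < eucl_dist v x + 1 by rewrite ltr_wpDl ?eucl_dist_ge0.
have [n] := exists_ratio_lt (divr_gt0 e0 d0).
rewrite ltr_pdivlMr // => hn; exists (phi_w phi (nseq n i) x); first exact: phi_w_K.
have {1}-> : v = phi_w phi (nseq n i) v by elim: n {hn} => //= n <-.
rewrite phi_w_dist size_nseq; apply: le_lt_trans hn.
by rewrite ler_wpM2l ?exprn_ge0 ?ltW ?ratio_gt0 // ltrDl.
Qed.

Lemma essential_finite : finite_set V0.
Proof.
pose p i := xget 0 [set v | phi i v = v].
apply: (@sub_finite_set _ _ (p @` setT)); last exact/finite_image/finite_finset.
move=> v /essential_fixed[i hi]; exists i => //; rewrite /p.
apply: (@fixed_point_unique i) => //.
by case: xgetP => [z _ //|/(_ v)/=].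
Qed.

Lemma VmP m x : Vm phi m x <-> exists2 w, size w = m & cell_vertices phi w x.
Proof.
elim: m x => [|m IH] x.
  split=> [h|[w /size0nil-> [y Vy <-]]] //.
  by exists [::] => //; exists x.
split=> [[i _ [y /IH[w sw [z Vz <-]] <-]]|].
  by exists (i :: w); rewrite /= ?sw //; exists z.
move=> [[//|i w] [sw] [z Vz <-]]; exists i => //; exists (phi_w phi w z) => //.
by apply/IH; exists w => //; exists z.
Qed.

Lemma cell_vertices_Vinf w : cell_vertices phi w `<=` Vinf phi.
Proof. by move=> x h; exists (size w) => //; apply/VmP; exists w. Qed.

Lemma Vinf_countable : countable (Vinf phi).
Proof.
suff : countable (\bigcup_(w : seq 'I_M) cell_vertices phi w).
  apply: sub_countable; apply: subset_card_le => x [m _ /VmP[w _ h]].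
  by exists w.
apply: bigcup_countable => [|w _]; first exact: countableP.
exact/finite_set_countable/finite_image/essential_finite.
Qed.

(** By nesting, two different cells of a level meet only in vertices. *)
Lemma cell_unique w w' x : ~ Vinf phi x -> size w = size w' ->
  cell phi K w x -> cell phi K w' x -> cell phi K w = cell phi K w'.
Proof.
move=> Vx sw cw cw'; have [//|ne] := pselect (cell phi K w = cell phi K w').
case: w sw cw ne => [|i w] sw cw ne.
  by move: ne; rewrite (size0nil (esym sw)).
have /seteqP[+ _] := nf_nesting nf (isT : (0 < (size w).+1)%N)
  (erefl (size (i :: w))) (esym sw) ne.
by move=> /(_ x (conj cw cw'))[/cell_vertices_Vinf].
Qed.

Lemma Delta_cell w x : ~ Vinf phi x -> cell phi K w x ->
  Delta phi K (size w) x = cell phi K w.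
Proof.
move=> Vx cw; rewrite /Delta; case: xgetP => [S _ [[w' /= sw <-] cw']|].
  exact: (cell_unique Vx).
by move=> /(_ (cell phi K w)) []; split=> //; exists w.
Qed.

End NestedFractal.

(** * Separation of points *)

Section Separation.
Context {R : realType} {N M : nat}.
Context (phi : 'I_M -> 'rV[R]_N -> 'rV[R]_N) (L : R) (K : set 'rV[R]_N).
Context (nf : nested_fractal phi L K).
Local Notation E := 'rV[R]_N.
Implicit Types (x y z : E) (w u : seq 'I_M).

(** If the cells of [x] and [y] met at every level, a common point would be within
    [L ^- m] of both, for all [m]. *)
Lemma separated_exists x y : (K `\` Vinf phi) x -> (K `\` Vinf phi) y ->
  x <> y -> exists m, separated_at phi K x y m.
Proof.
move=> [Kx Vx] [Ky Vy] xy; apply: contrapT => h; apply/xy/rowP => k.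
apply/eqP; rewrite -subr_eq0 -normr_le0 leNgt; apply/negP => d0.
have [n hn] := exists_ratio_lt nf (divr_gt0 d0 (ltr0n R 2)).
apply: h; exists n.+1; split=> //; apply/seteqP; split=> // z.
have [w sw cw] := cell_exists nf n.+1 Kx.
have [w' sw' cw'] := cell_exists nf n.+1 Ky.
rewrite -{1}sw -sw' (Delta_cell nf Vx cw) (Delta_cell nf Vy cw') => -[zw zw'].
have := coord_le_eucl_dist x z k; have := coord_le_eucl_dist z y k.
have := cell_dist nf cw zw; have := cell_dist nf zw' cw'.
have := ler_distD (z 0 k) (x 0 k) (y 0 k).
have : L^-1 ^+ n.+1 <= L^-1 ^+ n.
  by rewrite exprSr ler_piMr ?exprn_ge0 ?ltW ?(ratio_gt0 nf) ?(ratio_lt1 nf).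
rewrite sw sw'; lra.
Qed.

Lemma indP x y : (K `\` Vinf phi) x -> (K `\` Vinf phi) y -> x <> y ->
  separated_at phi K x y (ind phi K x y) /\
  forall k, separated_at phi K x y k -> (ind phi K x y <= k)%N.
Proof.
move=> Kx Ky xy; rewrite /ind; case: xgetP => [m _ //|].
have [m0 h0] := separated_exists Kx Ky xy.
have ex : exists m, `[<separated_at phi K x y m>] by exists m0; exact/asboolP.
case: (ex_minnP ex) => m /asboolP hm mn /(_ m) []; split=> // k hk.
by apply: mn; exact/asboolP.
Qed.

(** Just below the separation level the two points still lie in touching cells,
    which is what lets [f x] and [f y] be compared through a common point. *)
Lemma ind_pred_cells x y :
  (K `\` Vinf phi) x -> (K `\` Vinf phi) y -> x <> y ->
  exists w w' z, [/\ size w = (ind phi K x y).-1, size w' = size w,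
    cell phi K w x /\ cell phi K w' y,
    cell phi K w z /\ cell phi K w' z &
    Sxy phi K x y = cell phi K w `|` cell phi K w'].
Proof.
move=> Kx Ky xy; have [[i0 _] imin] := indP Kx Ky xy.
have [w sw cw] := cell_exists nf (ind phi K x y).-1 Kx.1.
have [w' sw' cw'] := cell_exists nf (ind phi K x y).-1 Ky.1.
have Dx := Delta_cell nf Kx.2 cw; have Dy := Delta_cell nf Ky.2 cw'.
suff [z zz] : cell phi K w `&` cell phi K w' !=set0.
  exists w, w', z; split => //; first by rewrite sw.
  by rewrite /Sxy -{1}sw -sw' Dx Dy.
rewrite -Dx -Dy sw sw'.
have [i1|i1] := leqP (ind phi K x y) 1%N.
  have -> : (ind phi K x y).-1 = size (@nil 'I_M) by case: (ind phi K x y) i1 => [|[]].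
  have c0 z : K z -> cell phi K [::] z by exists z.
  rewrite !(@Delta_cell _ _ _ _ _ _ nf [::]);
    [|exact: Ky.2|exact/c0/Ky.1|exact: Kx.2|exact/c0/Kx.1].
  by exists x; split; exact/c0/Kx.1.
have [//|/set0P/negP/negPn/eqP e] := pselect
  (Delta phi K (ind phi K x y).-1 x `&` Delta phi K (ind phi K x y).-1 y !=set0).
have : separated_at phi K x y (ind phi K x y).-1.
  by split=> //; rewrite -ltnS prednK.
by move=> /imin; rewrite -{1}(prednK i0) ltnn.
Qed.

Lemma separated_dist : property_P phi L K ->
  exists2 c : R, 0 < c & forall x y,
    (K `\` Vinf phi) x -> (K `\` Vinf phi) y -> x <> y ->
    c * L^-1 ^+ (ind phi K x y).-1 <= eucl_dist x y.
Proof.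
move=> [al al0 hP].
(* At level 1 the property says nothing; there are only finitely many pairs of
   disjoint 1-cells, and disjoint compact sets are a positive distance apart. *)
have /choice[d hd] (p : 'I_M * 'I_M) : exists d : R, 0 < d /\
    (cell phi K [:: p.1] `&` cell phi K [:: p.2] = set0 ->
     forall x y, cell phi K [:: p.1] x -> cell phi K [:: p.2] y -> d <= eucl_dist x y).
  have [e|ne] := pselect (cell phi K [:: p.1] `&` cell phi K [:: p.2] = set0).
    have [d d0 hd] := compact_disjoint_dist
      (@cell_compact _ _ _ _ _ _ nf _) (@cell_compact _ _ _ _ _ _ nf _) e.
    by exists d; split=> // _; exact: hd.
  by exists 1.
exists (\big[Num.min/al]_p d p).
  by apply/lt_bigmin => // p _; have [] := hd p.
move=> x y Kx Ky xy; have [[i0 dis] imin] := indP Kx Ky xy.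
case E : (ind phi K x y) (i0) => [//|n] _ /=.
have [w sw cw] := cell_exists nf n.+1 Kx.1.
have [w' sw' cw'] := cell_exists nf n.+1 Ky.1.
have Dx := Delta_cell nf Kx.2 cw; have Dy := Delta_cell nf Ky.2 cw'.
have cdis : cell phi K w `&` cell phi K w' = set0 by rewrite -Dx -Dy sw sw' -E.
case: n E sw sw' => [|n] E sw sw'.
  rewrite expr0 mulr1.
  move: w w' sw sw' cw cw' {Dx Dy} cdis => [|i []]// [|j []]// _ _ ci cj cij.
  apply: (le_trans (bigmin_le _ (i, j) _)).
  by have [_ /(_ cij _ _ ci cj)] := hd (i, j).
rewrite (le_trans (y := al * L^-1 ^+ n.+1)) //.
  apply: ler_wpM2r; last exact: bigmin_le_id.
  by rewrite exprn_ge0 // ltW ?(ratio_gt0 nf).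
rewrite exprVn; apply: hP => //; split.
  right; exists (Delta phi K n.+1 y) => /=; last first.
    have [v sv cv] := cell_exists nf n.+1 Ky.1.
    by rewrite -sv (Delta_cell nf Ky.2 cv).
  split.
    have [v sv cv] := cell_exists nf n.+1 Ky.1.
    by rewrite -{2}sv (Delta_cell nf Ky.2 cv); exists v.
  apply/set0P/negP => /eqP e.
  have /imin : separated_at phi K x y n.+1 by split => //; rewrite setIC.
  by rewrite E ltnn.
rewrite -[in Delta phi K n.+2 x]sw Dx.
case=> [cwy|[T /= [[v sv <-] [z [zv zw]]] cvy]].
  have : (cell phi K w `&` cell phi K w') y by [].
  by rewrite cdis.
have vw' : cell phi K v = cell phi K w' by apply: (cell_unique nf Ky.2); rewrite ?sv ?sw'.
have : (cell phi K w `&` cell phi K w') z by rewrite -vw'.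
by rewrite cdis.
Qed.

End Separation.

(** * Mass of the cells *)

Section HausdorffMeasure.
Context {R : realType} {N M : nat}.
Context (phi : 'I_M -> 'rV[R]_N -> 'rV[R]_N) (L : R) (K : set 'rV[R]_N).
Context (nf : nested_fractal phi L K).
Local Notation E := 'rV[R]_N.
Local Notation d := (dim_hausdorff M L).
Implicit Types (x y z : E) (w u : seq 'I_M) (A U : set E).

Lemma M_gt1 : 1 < M%:R :> R.
Proof. by rewrite ltr1n (nf_M nf). Qed.

Lemma M_gt0 : 0 < M%:R :> R.
Proof. exact: lt_trans ltr01 M_gt1. Qed.

Lemma lnL_gt0 : 0 < ln L.
Proof. exact/ln_gt0/nf_L/nf. Qed.

Lemma dim_ge0 : 0 <= d.
Proof. by rewrite divr_ge0 // ltW ?ln_gt0 ?M_gt1 ?(nf_L nf). Qed.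

Lemma ratio_powR_dim : L^-1 `^ d = M%:R^-1.
Proof.
have L0 : 0 < L by exact: lt_trans ltr01 (nf_L nf).
rewrite /powR gt_eqF ?invr_gt0 // lnV ?posrE // mulrN /dim_hausdorff.
by rewrite divfK ?gt_eqF ?lnL_gt0 // expRN lnK // posrE M_gt0.
Qed.

Lemma diam_ge0 U : (0 <= diam U)%E.
Proof. by rewrite /diam le_max lexx. Qed.

Lemma diam_phi i U : (diam (phi i @` U) <= L^-1%:E * diam U)%E.
Proof.
rewrite {1}/diam ge_max; apply/andP; split.
  by rewrite mule_ge0 ?diam_ge0 ?lee_fin ?ltW ?(ratio_gt0 nf).
apply: ge_ereal_sup => _ [[_ _] /= [[x Ux <-] [y Uy <-]] <-].
rewrite (nf_similitude nf) EFinM lee_pmul2l ?lte_fin ?(ratio_gt0 nf) //.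
by rewrite /diam le_max; apply/orP; right; apply: ereal_sup_ubound; exists (x, y).
Qed.

Lemma hausdorff_ge0 A : (0 <= hausdorff d A)%E.
Proof.
apply: (@le_trans _ _ (hausdorff_pre d 1 A)).
  apply: le_ereal_inf_tmp => _ [U _ <-].
  by apply: nneseries_ge0 => k _ _; exact: poweR_ge0.
by apply: ereal_sup_ubound; exists 1 => //=.
Qed.

(** Images under [phi i] of the sets of a cover form a cover whose sum is smaller
    by the factor [L ^- d = M ^-1]. *)
Lemma hausdorff_phi i A :
  (hausdorff d (phi i @` A) <= M%:R^-1%:E * hausdorff d A)%E.
Proof.
have Mi0 : 0 < M%:R^-1 :> R by rewrite invr_gt0 M_gt0.
apply: ge_ereal_sup => _ [e /= e0 <-].
apply: (@le_trans _ _ (M%:R^-1%:E * hausdorff_pre d e A)%E); last first.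
  by rewrite lee_pmul2l //; apply: ereal_sup_ubound; exists e.
rewrite -lee_pdivrMl ?invr_gt0 ?M_gt0 //; apply: le_ereal_inf_tmp => _ [U [AU Ue] <-].
rewrite lee_pdivrMl ?invr_gt0 ?M_gt0 //.
rewrite -nneseriesZl; last by move=> k _; exact: poweR_ge0.
apply: (@le_trans _ _ (\sum_(0 <= k <oo) (diam (phi i @` U k)) `^ d)%E).
  apply: ereal_inf_lbound; exists (fun k => phi i @` U k) => //; split.
    by move=> _ [x /AU[k _ Ux] <-]; exists k => //; exists x.
  move=> k; apply: le_trans (diam_phi _ _) _; apply: le_trans (Ue k).
  by rewrite gee_pMl ?diam_ge0 ?lee_fin ?ltW ?(ratio_lt1 nf).
apply: lee_nneseries => [k _ _|k _]; first exact: poweR_ge0.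
rewrite -ratio_powR_dim -poweR_EFin -poweRM ?diam_ge0 ?lee_fin ?(ltW (ratio_gt0 nf)) //.
apply: (gt0_ler_poweR dim_ge0); last exact: diam_phi.
  by rewrite in_itv /= leey diam_ge0.
by rewrite in_itv /= leey andbT mule_ge0 ?diam_ge0 ?lee_fin ?ltW ?(ratio_gt0 nf).
Qed.

Lemma hausdorff_cell w :
  (hausdorff d (cell phi K w) <= (M%:R^-1 ^+ size w)%:E * hausdorff d K)%E.
Proof.
elim: w => [|i w IH].
  by rewrite expr0 mul1e (_ : cell phi K [::] = K) // /cell /= image_id.
rewrite /= exprS EFinM -muleA.
have -> : cell phi K (i :: w) = phi i @` cell phi K w by rewrite /cell -image_comp.
apply: le_trans (hausdorff_phi _ _) _.
by rewrite lee_pmul2l ?lte_fin ?invr_gt0 ?M_gt0.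
Qed.

Lemma borelE_closed A : closed A -> measurable (A : set (borelE R N)).
Proof.
move=> cA; rewrite -(setCK A); apply: measurableC.
by apply: sub_gen_smallest; exact: closed_openC.
Qed.

Lemma cell_measurable w : measurable (cell phi K w : set (borelE R N)).
Proof. by apply: borelE_closed; exact: (cell_closed nf). Qed.

Context (mu : {measure set (borelE R N) -> \bar R}).
Context (mu_norm : normalized_hausdorff d K mu).

Lemma mu_cell_le w : (mu (cell phi K w) <= (M%:R^-1 ^+ size w)%:E)%E.
Proof.
have [[c hc] muK] := mu_norm.
have := hc _ (borelE_closed (K_closed nf)); rewrite setIid muK => hK.
have c0 : 0 < c.
  rewrite ltNge; apply/negP => c0; have : (c%:E * hausdorff d K <= 0)%E.
    by rewrite mule_le0_ge0 ?hausdorff_ge0 ?lee_fin.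
  by rewrite -hK lee_fin ler10.
rewrite hc; last exact: cell_measurable.
rewrite setIidl; last exact: (cell_sub nf).
apply: (@le_trans _ _ (c%:E * ((M%:R^-1 ^+ size w)%:E * hausdorff d K))%E).
  by rewrite lee_pmul2l // hausdorff_cell.
by rewrite muleCA -hK mule1.
Qed.

(** All [M ^ m] cells of level [m] are needed to exhaust the unit mass of [K],
    each contributing at most [M ^- m]: whatever replaces one of them in a cover
    must carry the mass [M ^- m] itself. *)
Lemma mu_cover_ge m (t : m.-tuple 'I_M) (B : set (borelE R N)) :
  measurable B ->
  K `<=` B `|` \bigcup_(u in [set u : m.-tuple 'I_M | u != t]) cell phi K u ->
  ((M%:R^-1 ^+ m)%:E <= mu B)%E.
Proof.
move=> mB KB; have [_ muK] := mu_norm.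
have mU (s : seq (m.-tuple 'I_M)) (P : pred (m.-tuple 'I_M)) :
    measurable (\big[setU/set0]_(u <- s | P u) (cell phi K u : set (borelE R N))).
  by apply: bigsetU_measurable => u _; exact: cell_measurable.
have le_big (s : seq (m.-tuple 'I_M)) (P : pred (m.-tuple 'I_M)) :
    (mu (\big[setU/set0]_(u <- s | P u) cell phi K u) <=
     \sum_(u <- s | P u) (M%:R^-1 ^+ m)%:E)%E.
  elim: s => [|u s IH]; first by rewrite !big_nil measure0.
  rewrite !big_cons; case: ifP => // _.
  apply: le_trans (measureU2 _ (cell_measurable u) (mU s P)) _.
  by apply: leeD => //; have := mu_cell_le u; rewrite size_tuple.
have : (mu K <= mu B +
    mu (\big[setU/set0]_(u <- enum {: m.-tuple 'I_M} | u != t) cell phi K u))%E.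
  apply: le_trans (measureU2 _ mB (mU _ _)).
  apply: le_measure; rewrite ?inE.
  - exact: borelE_closed (K_closed nf).
  - exact: measurableU.
  - move=> x /KB[Bx|[u /= ut ux]]; [by left|right].
    rewrite -bigcup_seq_cond; exists u => //=; by rewrite mem_enum.
rewrite muK => h.
have := le_trans h (leeD2l _ (le_big _ _)).
rewrite big_enum_cond /= sumEFin => {}h.
have S : \sum_(u : m.-tuple 'I_M | u != t) M%:R^-1 ^+ m = 1 - M%:R^-1 ^+ m :> R.
  have : \sum_(u : m.-tuple 'I_M) M%:R^-1 ^+ m = 1 :> R.
    rewrite sumr_const card_tuple card_ord -[LHS]mulr_natr natrX -exprMn.
    by rewrite mulVf ?expr1n // gt_eqF ?M_gt0.
  by rewrite (bigD1 t) //= => /(canRL (addKr _)) ->; rewrite addrC.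
move: h; rewrite S -leeBlDr // -EFinB => /(le_trans _); apply.
by rewrite lee_fin; lra.
Qed.

Lemma mu_cell_gt0 w : (0 < mu (cell phi K w))%E.
Proof.
apply: (@lt_le_trans _ _ (M%:R^-1 ^+ size w)%:E).
  by rewrite lte_fin exprn_gt0 // invr_gt0 M_gt0.
apply: (@mu_cover_ge _ (in_tuple w)); first exact: cell_measurable.
move=> x /(cell_exists nf (size w))[u su cu].
have [uw|uw] := eqVneq u w; first by left; rewrite -uw.
by right; exists (tcast su (in_tuple u)); rewrite /= -?val_eqE /= ?val_tcast.
Qed.

(** Two words sharing a cell would let fewer than [M ^ m] cells cover [K]. *)
Lemma cell_inj w w' : size w = size w' -> cell phi K w = cell phi K w' -> w = w'.
Proof.
move=> sw e; apply/eqP/negPn/negP => ne.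
have : ((M%:R^-1 ^+ size w)%:E <= mu set0)%E.
  apply: (@mu_cover_ge _ (in_tuple w)); first exact: measurable0.
  move=> x /(cell_exists nf (size w))[u su cu]; right.
  have [uw|uw] := eqVneq u w.
    exists (tcast (esym sw) (in_tuple w')); rewrite /= -?val_eqE /= ?val_tcast //.
      by rewrite eq_sym.
    by rewrite -e -uw.
  by exists (tcast su (in_tuple u)); rewrite /= -?val_eqE /= ?val_tcast.
by rewrite measure0 lee_fin leNgt exprn_gt0 // invr_gt0 M_gt0.
Qed.

Lemma address_cell w x : ~ Vinf phi x -> cell phi K w x ->
  address phi K (size w) x = w.
Proof.
move=> Vx cw; rewrite /address; case: xgetP => [w' _ /= [sw cw']|/(_ w)].
  by apply: cell_inj => //; exact: (cell_unique nf Vx).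
by case.
Qed.

End HausdorffMeasure.

(** * Energy forms *)

Lemma within_continuousP {R : realType} (T : topologicalType) (A : set T) (f : T -> R) :
  {within A, continuous f} <->
  forall x, A x -> forall e : R, 0 < e -> \forall y \near x, A y -> `|f x - f y| < e.
Proof.
split=> [/subspace_continuousP h x Ax e e0|h].
  by have /cvgrPdist_lt/(_ _ e0) := h x Ax; rewrite near_withinE.
apply/subspace_continuousP => x Ax; apply/cvgrPdist_lt => e e0.
by rewrite near_withinE; exact: h.
Qed.

Section Energy.
Context {R : realType} {N M : nat}.
Context (phi : 'I_M -> 'rV[R]_N -> 'rV[R]_N) (L : R) (K : set 'rV[R]_N).
Context (a : 'rV[R]_N -> 'rV[R]_N -> R) (rho : R).
Context (nf : nested_fractal phi L K) (hs : harmonic_structure phi a rho).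
Local Notation E := 'rV[R]_N.
Local Notation V0 := (essential phi).
Local Notation energy0 := (energy0 phi a).
Local Notation energym := (energym phi a rho).
Local Notation energy := (energy phi a rho).
Local Notation D := (energy_domain phi K a rho).
Implicit Types (f g h : E -> R) (x y z : E) (w u : seq 'I_M).

Lemma rho_gt1 : 1 < rho. Proof. exact: hs_rho hs. Qed.
Lemma rho_gt0 : 0 < rho. Proof. exact: lt_trans ltr01 rho_gt1. Qed.
Lemma rho_ge0 : 0 <= rho. Proof. exact/ltW/rho_gt0. Qed.

Lemma energy0E f g : energy0 f g =
  2^-1 * \sum_(x <- fset_set V0) \sum_(y <- fset_set V0)
            a x y * (f x - f y) * (g x - g y).
Proof.
rewrite /Defs.energy0 fsbig_finite /=; last exact: (essential_finite nf).
congr (_ * _); apply: eq_bigr => x _.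
by rewrite fsbig_finite //=; exact: (essential_finite nf).
Qed.

Lemma mem_V0 x : x \in fset_set V0 -> V0 x.
Proof. by rewrite in_fset_set ?inE //; exact: (essential_finite nf). Qed.

Lemma V0_mem x : V0 x -> x \in fset_set V0.
Proof. by move=> ?; rewrite in_fset_set ?inE //; exact: (essential_finite nf). Qed.

Lemma energymE m f g : energym m f g = rho ^+ m * \sum_(w : m.-tuple 'I_M)
  2^-1 * \sum_(x <- fset_set V0) \sum_(y <- fset_set V0)
     a x y * (f (phi_w phi w x) - f (phi_w phi w y)) * (g (phi_w phi w x) - g (phi_w phi w y)).
Proof. by congr (_ * _); apply: eq_bigr => w _; rewrite energy0E. Qed.

Lemma energymC m f g : energym m f g = energym m g f.
Proof.
congr (_ * _); apply: eq_bigr => w _; congr (_ * _).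
by do 2!(apply: eq_fsbigr => ? _); rewrite mulrAC.
Qed.

Lemma energym_lin m (c : R) f g h :
  energym m (fun x => c * f x + g x) h = c * energym m f h + energym m g h.
Proof.
rewrite !energymE mulrCA -mulrDr; congr (_ * _).
rewrite mulr_sumr -big_split; apply: eq_bigr => w _ /=.
rewrite mulrCA -mulrDr; congr (_ * _).
rewrite mulr_sumr -big_split; apply: eq_bigr => x _ /=.
by rewrite mulr_sumr -big_split; apply: eq_bigr => y _ /=; ring.
Qed.

Lemma conductance_term_ge0 f x y : x \in fset_set V0 -> y \in fset_set V0 ->
  0 <= a x y * (f x - f y) * (f x - f y).
Proof.
move=> /mem_V0 Vx /mem_V0 Vy; have [->|/eqP xy] := eqVneq x y.
  by rewrite subrr !mulr0.
rewrite -mulrA mulr_ge0 //; last by rewrite -expr2 sqr_ge0.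
exact: (cm_ge0 (hs_conductivity hs)).
Qed.

Lemma energy0_ge0 f : 0 <= energy0 f f.
Proof.
rewrite energy0E mulr_ge0 ?invr_ge0 //.
rewrite big_seq; apply: sumr_ge0 => x Vx; rewrite big_seq; apply: sumr_ge0 => y Vy.
exact: conductance_term_ge0.
Qed.

Lemma energym_ge0 m f : 0 <= energym m f f.
Proof.
rewrite mulr_ge0 ?exprn_ge0 ?rho_ge0 //.
by apply: sumr_ge0 => w _; exact: energy0_ge0.
Qed.

Lemma energym_ext m f f' g : {in K, f =1 f'} -> energym m f g = energym m f' g.
Proof.
move=> ff'; rewrite !energymE; congr (_ * _); apply: eq_bigr => w _; congr (_ * _).
rewrite big_seq [RHS]big_seq; apply: eq_bigr => x /mem_V0 Vx.
rewrite big_seq [RHS]big_seq; apply: eq_bigr => y /mem_V0 Vy.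
by rewrite !ff' ?inE //; apply: (phi_w_K nf); exact: (essential_K nf).
Qed.

Lemma energym_cst m c g : energym m (cst c) g = 0.
Proof.
rewrite energymE big1 ?mulr0 // => w _; rewrite big1 ?mulr0 // => x _.
by rewrite big1 // => y _; rewrite /cst subrr mulr0 mul0r.
Qed.

Lemma energym0 f g : energym 0 f g = energy0 f g.
Proof.
rewrite /Defs.energym expr0 mul1r (big_pred1 [tuple]) // => w.
by apply/esym/eqP; rewrite tuple0.
Qed.

(** Words of length [m + 1] are split into their first letter, the outermost map,
    and the rest. *)
Lemma energymS m f g : energym m.+1 f g =
  rho * \sum_(i < M) energym m (f \o phi i) (g \o phi i).
Proof.
rewrite [LHS]/Defs.energym exprS -mulrA; congr (_ * _).
rewrite /Defs.energym.
rewrite -[RHS]mulr_sumr; congr (_ * _); rewrite pair_big /=.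
rewrite (reindex (fun p : 'I_M * m.-tuple 'I_M => [tuple of p.1 :: p.2])) //=.
exists (fun t : m.+1.-tuple 'I_M => (thead t, [tuple of behead t])) => [[i t] _|t _] /=.
  by congr (_, _); apply: val_inj.
by apply: val_inj; rewrite /= [in RHS](tuple_eta t).
Qed.

(** The renormalization identity makes [rho^-1 * energy0 f f] an infimum over the
    extensions of [f] to the next level, and [f] is such an extension of itself. *)
Lemma energy0_le_energy1 f : energy0 f f <= energym 1 f f.
Proof.
rewrite energymS; under eq_bigr do rewrite energym0.
have r0 := rho_gt0; rewrite -ler_pdivrMl // -(hs_renormalization hs).
apply: ge_inf; last by exists f.
by exists 0 => _ [g _ <-]; apply: sumr_ge0 => i _; exact: energy0_ge0.
Qed.

Lemma energym_le1 m f : energym m f f <= energym m.+1 f f.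
Proof.
elim: m f => [|m IH] f; first by rewrite energym0 energy0_le_energy1.
rewrite energymS [leRHS]energymS ler_pM2l ?rho_gt0 //.
by apply: ler_sum => i _; exact: IH.
Qed.

Lemma energym_nondecreasing f : nondecreasing_seq (fun m => energym m f f).
Proof. by apply/nondecreasing_seqP => m; exact: energym_le1. Qed.

Lemma energym_comp w k f :
  rho ^+ size w * energym k (f \o phi_w phi w) (f \o phi_w phi w)
  <= energym (size w + k) f f.
Proof.
elim: w f => [|i w IH] f /=; first by rewrite expr0 mul1r.
rewrite addSn energymS exprS -mulrA ler_pM2l ?rho_gt0 //.
apply: le_trans (IH (f \o phi i)) _; rewrite (bigD1 i) //= lerDl.
by apply: sumr_ge0 => j _; exact: energym_ge0.
Qed.

Lemma energym_sqr m c f g :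
  energym m (fun x => c * f x + g x) (fun x => c * f x + g x) =
  c ^+ 2 * energym m f f + 2 * c * energym m f g + energym m g g.
Proof.
rewrite energym_lin (energymC _ f) (energymC _ g) !energym_lin (energymC _ g f).
ring.
Qed.

Lemma energym_le2 m c f g :
  energym m (fun x => c * f x + g x) (fun x => c * f x + g x) <=
  2 * c ^+ 2 * energym m f f + 2 * energym m g g.
Proof.
have := energym_ge0 m (fun x => - c * f x + g x); rewrite !energym_sqr; lra.
Qed.

Lemma energym_cvg f : D f -> energym m f f @[m --> \oo] --> energy f f.
Proof.
by move=> [_ ub]; apply: nondecreasing_is_cvgn => //; exact: energym_nondecreasing.
Qed.

Lemma energym_le_energy m f : D f -> energym m f f <= energy f f.
Proof.
move=> Df; apply: (nondecreasing_cvgn_le (energym_nondecreasing f)).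
by apply: cvgP; exact: energym_cvg Df.
Qed.

Lemma energy_le f (c : R) : D f -> (forall m, energym m f f <= c) -> energy f f <= c.
Proof.
move=> Df h; apply: limr_le; first exact/cvgP/(energym_cvg Df).
by apply: nearW.
Qed.

Lemma energy_domain_lin c f g : D f -> D g -> D (fun x => c * f x + g x).
Proof.
move=> Df Dg; split.
  move=> x; apply: cvgD; last exact: Dg.1.
  by apply: cvgM; [exact: cvg_cst|exact: Df.1].
exists (2 * c ^+ 2 * energy f f + 2 * energy g g) => _ [m _ <-].
apply: le_trans (energym_le2 _ _ _ _) _; apply: lerD.
  by rewrite ler_wpM2l ?energym_le_energy // mulr_ge0 ?sqr_ge0.
by rewrite ler_wpM2l ?energym_le_energy.
Qed.

Lemma energy_domain_cst c : D (cst c).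
Proof.
split; first by move=> x; exact: cvg_cst.
by exists 0 => _ [m _ <-]; rewrite energym_cst.
Qed.

Lemma energy_domain_ext f g : {in K, f =1 g} -> D f -> D g.
Proof.
move=> fg [cf [c hc]]; split.
  apply/within_continuousP => x Kx e e0.
  have /within_continuousP/(_ x Kx e e0) := cf.
  by apply: filterS => y h Ky; rewrite -!fg ?inE //; exact: h.
exists c => _ [m _ <-]; rewrite -(energym_ext _ _ fg) energymC -(energym_ext _ _ fg).
by apply: hc; exists m.
Qed.

Lemma energy_domain_comp w f : D f -> D (f \o phi_w phi w).
Proof.
move=> Df; split.
  apply/within_continuousP => x Kx e e0.
  have /within_continuousP/(_ _ (phi_w_K nf w Kx) e e0) h := Df.1.
  have hw : \forall y \near x, K (phi_w phi w y) ->
      `|f (phi_w phi w x) - f (phi_w phi w y)| < e.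
    exact: (@phi_w_continuous _ _ _ _ _ _ nf w x _ h).
  apply: filterS hw => y hy Ky; apply: hy; exact: (phi_w_K nf).
exists (rho ^- size w * energy f f) => _ [m _ <-].
rewrite ler_pdivlMl ?exprn_gt0 ?rho_gt0 //.
exact: le_trans (energym_comp _ _ _) (energym_le_energy _ Df).
Qed.

(** Polarization reduces mixed energies to the monotone convergence of
    [energym m f f]. *)
Lemma energy_cvg f g : D f -> D g -> energym m f g @[m --> \oo] --> energy f g.
Proof.
move=> Df Dg.
suff : cvgn (fun m => energym m f g) by [].
have -> : (fun m => energym m f g) = (fun m => 4^-1 *
    (energym m (fun x => 1 * f x + g x) (fun x => 1 * f x + g x) -
     energym m (fun x => -1 * f x + g x) (fun x => -1 * f x + g x))).
  by apply/funext => m; rewrite !energym_sqr; field.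
apply: is_cvgM; first exact: is_cvg_cst.
apply: is_cvgB; apply: cvgP; apply: energym_cvg; exact: energy_domain_lin.
Qed.

Lemma energyC f g : energy f g = energy g f.
Proof. by rewrite /Defs.energy; under eq_fun do rewrite energymC. Qed.

Lemma energy_unique f g (l : R) : energym m f g @[m --> \oo] --> l -> energy f g = l.
Proof. by move=> h; apply: cvg_lim. Qed.

Lemma energy_lin c f g h : D f -> D g -> D h ->
  energy (fun x => c * f x + g x) h = c * energy f h + energy g h.
Proof.
move=> Df Dg Dh; apply: energy_unique.
under eq_fun do rewrite energym_lin.
by apply: cvgD; [apply: cvgM; [exact: cvg_cst|]|]; exact: energy_cvg.
Qed.

Lemma energy_ext f f' g : {in K, f =1 f'} -> energy f g = energy f' g.
Proof.
move=> ff'; rewrite /Defs.energy.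
by have -> : (fun m => energym m f g) = (fun m => energym m f' g)
  by apply/funext => m; exact: energym_ext.
Qed.

Lemma energy_cst c g : energy (cst c) g = 0.
Proof.
by apply: energy_unique; under eq_fun do rewrite energym_cst; exact: cvg_cst.
Qed.

Lemma energy_ge0 f : D f -> 0 <= energy f f.
Proof. by move=> Df; exact: le_trans (energym_ge0 0 f) (energym_le_energy _ Df). Qed.

Lemma energy_sqr c f g : D f -> D g ->
  energy (fun x => c * f x + g x) (fun x => c * f x + g x) =
  c ^+ 2 * energy f f + 2 * c * energy f g + energy g g.
Proof.
move=> Df Dg; have Dl := energy_domain_lin c Df Dg.
rewrite energy_lin // (energyC f) (energyC g) !energy_lin // (energyC g f).
ring.
Qed.

Lemma energy_selfsimilar f g : D f -> D g ->
  energy f g = rho * \sum_(i < M) energy (f \o phi i) (g \o phi i).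
Proof.
move=> Df Dg; apply: energy_unique; rewrite -(cvg_shiftS (fun m => energym m f g)).
under eq_fun do rewrite energymS.
apply: cvgM; first exact: cvg_cst.
apply: cvg_big => [|i _]; [exact: add_continuous|]; apply: energy_cvg; exact: (@energy_domain_comp [:: i]).
Qed.

End Energy.

(** * Oscillation and energy *)

(** Links add up by [(s + t)^2 <= 2 s^2 + 2 t^2]; this turns the hypotheses of
    connectedness, stated as reflexive transitive closures, into inequalities. *)
Lemma clos_increment_bound {R : realType} (T : Type) (Q : (T -> R) -> R) (r : T -> T -> Prop) :
  (forall g, 0 <= Q g) ->
  (forall u v, r u v -> exists2 c : R, 0 <= c & forall g, (g u - g v) ^+ 2 <= c * Q g) ->
  forall u v, clos_refl_trans T r u v ->
    exists2 c : R, 0 <= c & forall g, (g u - g v) ^+ 2 <= c * Q g.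
Proof.
move=> Q0 hr u v; elim=> {u v} [u v /hr//|u|u v w _ [c c0 hc] _ [d d0 hd]].
  by exists 0 => // g; rewrite subrr expr0n mul0r.
exists (2 * c + 2 * d); first by rewrite addr_ge0 ?mulr_ge0.
move=> g; have := hc g; have := hd g; have := sqr_ge0 ((g u - g v) - (g v - g w)).
nra.
Qed.

Section Morrey.
Context {R : realType} {N M : nat}.
Context (phi : 'I_M -> 'rV[R]_N -> 'rV[R]_N) (L : R) (K : set 'rV[R]_N).
Context (a : 'rV[R]_N -> 'rV[R]_N -> R) (rho : R).
Context (nf : nested_fractal phi L K) (hs : harmonic_structure phi a rho).
Local Notation E := 'rV[R]_N.
Local Notation V0 := (essential phi).
Local Notation energy0 := (energy0 phi a).
Local Notation energym := (energym phi a rho).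
Local Notation energy := (energy phi a rho).
Local Notation D := (energy_domain phi K a rho).
Implicit Types (f g h : E -> R) (x y z u v : E) (w : seq 'I_M).

Lemma energy0_increment_bound u v : V0 u -> V0 v ->
  exists2 c : R, 0 <= c & forall g, (g u - g v) ^+ 2 <= c * energy0 g g.
Proof.
move=> Vu Vv; have := hs_irreducible hs Vu Vv.
apply: (clos_increment_bound (Q := fun g => energy0 g g)) => [g|{Vu Vv}u {}v].
  exact: (energy0_ge0 nf hs).
move=> [Vu Vv uv auv]; exists (2 / a u v); first by rewrite divr_ge0 ?ltW.
move=> g; rewrite mulrAC ler_pdivlMr // mulrC -ler_pdivrMl // (energy0E _ nf).
rewrite ler_pM2l ?invr_gt0 //.
rewrite (bigD1_seq u) ?fset_uniq ?(V0_mem nf) //= (bigD1_seq v) ?fset_uniq ?(V0_mem nf) //=.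
rewrite expr2 mulrA -addrA lerDl addr_ge0 // big_seq_cond sumr_ge0 // => x /andP[Vx _].
  by apply: (conductance_term_ge0 nf hs) => //; exact: (V0_mem nf).
by rewrite big_seq sumr_ge0 // => y Vy; exact: (conductance_term_ge0 nf hs).
Qed.

(** Irreducibility of the conductances joins the vertices inside one cell, and
    connectedness of the first-level graph joins the cells. *)
Lemma energy1_increment_bound v0 : V0 v0 ->
  exists2 c : R, 0 <= c & forall i g, (g (phi i v0) - g v0) ^+ 2 <= c * energym 1 g g.
Proof.
move=> V0v0.
have e1 i g : energy0 (g \o phi i) (g \o phi i) <= rho^-1 * energym 1 g g.
  have r0 := rho_gt0 hs; rewrite ler_pdivlMl //.
  have := @energym_comp _ _ _ _ _ _ _ _ nf hs [:: i] 0 g.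
  by rewrite /= expr1 addn0 energym0.
have V1 i : Vm phi 1 (phi i v0) by exists i => //; exists v0.
have /choice[c hc] i : exists c : R, 0 <= c /\
    forall g, (g (phi i v0) - g v0) ^+ 2 <= c * energym 1 g g.
  have [j hj] := essential_fixed V0v0.
  have := nf_connected nf (V1 i) (V1 j); rewrite hj => hC.
  have [|u v [k [[u' Vu <-] [v' Vv <-]]]|c c0 hc] :=
    clos_increment_bound (Q := fun g => energym 1 g g) _ _ hC.
  - by move=> g; exact: (energym_ge0 nf hs).
  - have [c c0 hc] := energy0_increment_bound Vu Vv.
    exists (c * rho^-1); first by rewrite mulr_ge0 ?invr_ge0 ?(rho_ge0 hs).
    move=> g; apply: le_trans (hc (g \o phi k)) _.
    by rewrite -mulrA ler_wpM2l.
  - by exists c.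
exists (\sum_i c i); first by apply: sumr_ge0 => i _; case: (hc i).
move=> i g; apply: le_trans ((hc i).2 g) _.
rewrite ler_wpM2r ?(energym_ge0 nf hs) // (bigD1 i) //= lerDl.
by apply: sumr_ge0 => j _; case: (hc j).
Qed.

Lemma energy_comp_le i g : D g -> energy (g \o phi i) (g \o phi i) <= rho^-1 * energy g g.
Proof.
move=> Dg; have r0 := rho_gt0 hs; rewrite ler_pdivlMl // [leRHS](energy_selfsimilar nf hs) //.
rewrite ler_pM2l // (bigD1 i) //= lerDl; apply: sumr_ge0 => j _.
by apply: (energy_ge0 nf hs); exact: (@energy_domain_comp _ _ _ _ _ _ _ _ nf hs [:: j]).
Qed.

(** Morrey-type estimate: descending through the cells around a point, the
    increments of [g] between consecutive levels decay like [rho ^- (m / 2)], so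
    they form a convergent geometric series bounded by the energy. The induction
    peels off the coarsest letter, which leaves a rescaled copy of the claim. *)
Lemma oscillation_bound :
  exists2 C : R, 0 <= C & forall g x y, D g -> K x -> K y ->
    (g x - g y) ^+ 2 <= C * energy g g.
Proof.
have [v0 [_ [Vv0 _ _]]] := nf_r nf.
have [c c0 hc] := energy1_increment_bound Vv0.
pose s := Num.sqrt rho^-1.
have s0 : 0 <= s by exact: sqrtr_ge0.
have s1 : s < 1.
  by rewrite -sqrtr1 ltr_sqrt // invf_lt1 ?(rho_gt0 hs) ?(rho_gt1 hs).
pose B := (1 - s)^-1.
have B0 : 0 < B by rewrite invr_gt0 subr_gt0.
(* [B] sums the geometric series: one more level contributes the summand 1. *)
have BE : B * s + 1 = B by rewrite /B; field; rewrite subr_eq0 eq_sym lt_eqF.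
have approx m : forall g x, D g -> K x -> exists2 z, K z &
    eucl_dist x z <= L^-1 ^+ m /\ `|g z - g v0| <= B * Num.sqrt (c * energy g g).
  elim: m => [|m IH] g x Dg Kx.
    exists v0; first exact: (essential_K nf).
    split; first by apply: (K_dist nf) => //; exact: (essential_K nf).
    by rewrite subrr normr0 mulr_ge0 ?sqrtr_ge0 ?ltW.
  have [i [y [Ky ->]]] := K_phi nf Kx.
  have Dgi : D (g \o phi i) by exact: (@energy_domain_comp _ _ _ _ _ _ _ _ nf hs [:: i]).
  have [z Kz [xz hz]] := IH _ _ Dgi Ky.
  exists (phi i z); first exact: (phi_K nf).
  split.
    by rewrite (nf_similitude nf) exprS ler_pM2l ?(ratio_gt0 nf).
  apply: le_trans (ler_distD (g (phi i v0)) _ _) _.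
  rewrite -[in leRHS]BE mulrDl mul1r; apply: lerD.
    apply: le_trans hz _; rewrite -mulrA ler_pM2l // -sqrtrM ?invr_ge0 ?(rho_ge0 hs) //.
    by rewrite ler_wsqrtr // mulrCA ler_wpM2l // energy_comp_le.
  rewrite -sqrtr_sqr ler_wsqrtr //; apply: le_trans (hc i g) _.
  by rewrite ler_wpM2l // (energym_le_energy nf hs).
have bound g x : D g -> K x -> `|g x - g v0| <= B * Num.sqrt (c * energy g g).
  move=> Dg Kx; apply/ler_addgt0Pl => e e0.
  have /within_continuousP/(_ x Kx _ e0)/nbhs_ballP[d /= d0 hd] := Dg.1.
  have [m hm] := exists_ratio_lt nf d0.
  have [z Kz [xz hz]] := approx m g x Dg Kx.
  apply: le_trans (ler_distD (g z) _ _) _; rewrite lerD // ltW // hd //.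
  by apply: eucl_dist_ball => //; exact: le_lt_trans hm.
exists ((2 * B) ^+ 2 * c); first by rewrite mulr_ge0 ?sqr_ge0.
move=> g x y Dg Kx Ky.
have e0 : 0 <= c * energy g g by rewrite mulr_ge0 // (energy_ge0 nf hs).
rewrite -real_normK ?num_real // -mulrA -[c * _]sqr_sqrtr // -exprMn.
rewrite lerXn2r ?nnegrE ?mulr_ge0 ?sqrtr_ge0 ?(ltW B0) //.
apply: le_trans (ler_distD (g v0) _ _) _.
rewrite (distrC (g v0)); have := bound _ _ Dg Kx; have := bound _ _ Dg Ky.
by lra.
Qed.

End Morrey.

(** * Existence of harmonic extensions *)

Lemma cvg_le_bound {R : realType} (u : nat -> R) (l c : R) :
  u k @[k --> \oo] --> l -> (\forall k \near \oo, u k <= c) -> l <= c.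
Proof.
move=> ul uc; have <- : lim (u k @[k --> \oo]) = l by exact: cvg_lim.
by apply: limr_le => //; apply: cvgP; exact: ul.
Qed.

Section HarmonicExtension.
Context {R : realType} {N M : nat}.
Context (phi : 'I_M -> 'rV[R]_N -> 'rV[R]_N) (L : R) (K : set 'rV[R]_N).
Context (a : 'rV[R]_N -> 'rV[R]_N -> R) (rho : R).
Context (nf : nested_fractal phi L K) (hs : harmonic_structure phi a rho).
Local Notation E := 'rV[R]_N.
Local Notation V0 := (essential phi).
Local Notation energym := (energym phi a rho).
Local Notation energy := (energy phi a rho).
Local Notation D := (energy_domain phi K a rho).
Local Notation harmonic_extension := (harmonic_extension phi K a rho).
Implicit Types (f g h : E -> R) (x y z : E) (w : seq 'I_M).

Lemma inv_nat_small (e : R) : 0 < e -> exists k, forall l, (k <= l)%N -> l.+1%:R^-1 < e.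
Proof. by move=> e0; have [k _ h] := near_infty_natSinv_lt (PosNum e0); exists k. Qed.

(** Functions with energies close to the minimum are close to each other, by the
    parallelogram identity: their midpoint cannot have an energy below the
    minimum. *)
Lemma energy_parallelogram_le (I c c' : R) f g : D f -> D g ->
  (forall h, D h -> (forall x, V0 x -> f x = g x -> h x = g x) -> I <= energy h h) ->
  energy f f <= I + c -> energy g g <= I + c' ->
  energy (fun x => -1 * f x + g x) (fun x => -1 * f x + g x) <= 2 * c + 2 * c'.
Proof.
move=> Df Dg mn hf hg; pose u := fun x => -1 * f x + g x.
have Du : D u := energy_domain_lin nf hs (-1) Df Dg.
have := mn _ (energy_domain_lin nf hs (- 2^-1) Du Dg).
have uu := energy_sqr nf hs (-1) Df Dg.
rewrite (energy_sqr nf hs _ Du Dg) (energy_lin nf hs _ Df Dg Dg) uu /u.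
have h0 x : V0 x -> f x = g x -> - 2^-1 * (-1 * f x + g x) + g x = g x.
  by move=> _ ->; ring.
move=> /(_ h0); lra.
Qed.

Lemma cauchy_uniform_limit (G : nat -> E -> R) :
  (forall k, {within K, continuous (G k)}) ->
  (forall e : R, 0 < e -> exists k, forall l l' x, (k <= l)%N -> (k <= l')%N ->
     K x -> `|G l x - G l' x| < e) ->
  exists h, [/\ {within K, continuous h}, forall x, ~ K x -> h x = 0 &
    forall x, K x -> G k x @[k --> \oo] --> h x].
Proof.
move=> cG uG; pose h := patch (cst 0) K (fun x => limn (fun k => G k x)).
have hcvg x : K x -> G k x @[k --> \oo] --> h x.
  move=> Kx; rewrite /h patchT ?inE //.
  suff : cvgn (fun k => G k x) by [].
  apply/cauchy_cvgP/cauchy_exP => e e0; have [k hk] := uG _ e0.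
  exists (G k x); exists k => // l /= kl; exact: hk.
exists h; split => [|x /= Kx|//]; last by rewrite /h patchC // inE.
apply/within_continuousP => x Kx e e0.
have e3 : 0 < e / 3 by rewrite divr_gt0.
have [k hk] := uG _ e3.
have hG y : K y -> `|G k y - h y| <= e / 3.
  move=> Ky; have : `|G k y - G l y| @[l --> \oo] --> `|G k y - h y|.
    by apply: cvg_norm; apply: cvgB; [exact: cvg_cst|exact: hcvg].
  by move/cvg_le_bound; apply; exists k => // l /= kl; apply/ltW/hk.
have /within_continuousP/(_ x Kx _ e3) := cG k.
apply: filterS => y /[swap] Ky /(_ Ky) xy.
have := hG _ Kx; have := hG _ Ky.
have := ler_distD (G k x) (h x) (h y); have := ler_distD (G k y) (G k x) (h y).
rewrite (distrC (h x) (G k x)); lra.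
Qed.

(** Existence of the harmonic extension by the direct method: a minimizing
    sequence is Cauchy for the energy, hence uniformly Cauchy on [K] by the
    oscillation bound, and each [energym m] passes to the limit. *)
Lemma harmonic_extension_exists g0 : D g0 -> exists h, harmonic_extension g0 h.
Proof.
move=> Dg0; pose A := [set g | D g /\ forall x, V0 x -> g x = g0 x].
pose S := [set energy g g | g in A]; pose I := inf S.
have Slb : has_lbound S by exists 0 => _ [g [Dg _] <-]; exact: (energy_ge0 nf hs).
have Shas : has_inf S by split => //; exists (energy g0 g0), g0.
have Imin g : A g -> I <= energy g g by move=> Ag; apply: ge_inf => //; exists g.
have /choice[G hG] k : exists g, A g /\ energy g g <= I + k.+1%:R^-1.
  have k0 : 0 < k.+1%:R^-1 :> R by rewrite invr_gt0.
  have [_ [g Ag <-] hg] := inf_adherent k0 Shas.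
  by exists g; split=> //; exact: ltW.
have [C C0 osc] := oscillation_bound nf hs.
have [v0 [_ [Vv0 _ _]]] := nf_r nf.
have Kv0 := essential_K nf Vv0.
have diff l l' x : K x ->
    (G l x - G l' x) ^+ 2 <= C * (2 * l.+1%:R^-1 + 2 * l'.+1%:R^-1).
  move=> Kx; have [[Dl Vl] El] := hG l; have [[Dl' Vl'] El'] := hG l'.
  have Dd := energy_domain_lin nf hs (-1) Dl Dl'.
  have := osc _ x v0 Dd Kx Kv0; rewrite (Vl v0) // (Vl' v0) //.
  have -> : (-1 * G l x + G l' x - (-1 * g0 v0 + g0 v0)) ^+ 2 = (G l x - G l' x) ^+ 2 by ring.
  move=> h; apply: le_trans h _; rewrite ler_wpM2l //.
  apply: (energy_parallelogram_le Dl Dl' _ El El') => h Dh hV.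
  by apply: Imin; split => // y Vy; rewrite hV ?Vl ?Vl'.
have [h [ch h0 hcvg]] : exists h, [/\ {within K, continuous h}, forall x, ~ K x -> h x = 0 &
    forall x, K x -> G k x @[k --> \oo] --> h x].
  apply: cauchy_uniform_limit => [k|e e0]; first by have [[[]]] := hG k.
  have d0 : 0 < e ^+ 2 / (4 * (C + 1)).
    by rewrite divr_gt0 ?exprn_gt0 ?mulr_gt0 // ltr_wpDl.
  have [k hk] := inv_nat_small d0; exists k => l l' x kl kl' Kx.
  rewrite -(ltr_pXn2r (n := 2)) ?nnegrE ?(ltW e0) // real_normK ?num_real //.
  apply: le_lt_trans (diff l l' x Kx) _.
  have := hk _ kl; have := hk _ kl'; rewrite !ltr_pdivlMr ?mulr_gt0 ?ltr_wpDl //.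
  have : 0 < l.+1%:R^-1 :> R by rewrite invr_gt0.
  have : 0 < l'.+1%:R^-1 :> R by rewrite invr_gt0.
  move: (l.+1%:R^-1) (l'.+1%:R^-1) => A1 A2; lra.
have hE m : energym m h h <= I.
  have hm : energym m (G k) (G k) @[k --> \oo] --> energym m h h.
    rewrite (energymE _ _ nf); under eq_fun do rewrite (energymE _ _ nf).
    apply: cvgM; first exact: cvg_cst.
    apply: cvg_big => [|w _]; first exact: add_continuous.
    apply: cvgM; first exact: cvg_cst.
    rewrite big_seq; under eq_fun do rewrite big_seq.
    apply: cvg_big => [|x /(mem_V0 nf) Vx]; first exact: add_continuous.
    rewrite big_seq; under eq_fun do rewrite big_seq.
    apply: cvg_big => [|y /(mem_V0 nf) Vy]; first exact: add_continuous.
    have hc z : V0 z -> G k (phi_w phi w z) @[k --> \oo] --> h (phi_w phi w z).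
      by move=> Vz; apply: hcvg; apply: (phi_w_K nf); exact: (essential_K nf).
    apply: cvgM; last by apply: cvgB; exact: hc.
    by apply: cvgM; [exact: cvg_cst|apply: cvgB; exact: hc].
  apply/ler_addgt0Pl => e e0; have [k hk] := inv_nat_small e0.
  apply: (cvg_le_bound hm); exists k => // l /= kl; have [[Dl _] El] := hG l.
  apply: le_trans (energym_le_energy nf hs m Dl) _; apply: le_trans El _.
  by rewrite addrC lerD2r ltW ?hk.
have Dh : D h by split=> //; exists I => _ [m _ <-].
have hV x : V0 x -> h x = g0 x.
  move=> Vx; have := hcvg _ (essential_K nf Vx).
  have -> : (fun k => G k x) = cst (g0 x) by apply/funext => k; have [[_ ->]] := hG k.
  by move=> hx; rewrite -(cvg_lim (@Rhausdorff R) hx) lim_cst.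
exists h; split => // g Dg gV; apply: le_trans (energy_le nf hs Dh hE) _.
exact: Imin.
Qed.

Lemma Hext_spec g : D g -> harmonic_extension g (Hext phi K a rho g).
Proof.
move=> Dg; rewrite /Hext; case: xgetP => [h _ //|nh].
by have [h hh] := harmonic_extension_exists Dg; case: (nh h).
Qed.

End HarmonicExtension.

(** * Harmonic functions in coordinates *)

Section HarmonicMatrices.
Context {R : realType} {N M : nat}.
Context (phi : 'I_M -> 'rV[R]_N -> 'rV[R]_N) (L : R) (K : set 'rV[R]_N).
Context (a : 'rV[R]_N -> 'rV[R]_N -> R) (rho : R).
Context (nf : nested_fractal phi L K) (hs : harmonic_structure phi a rho).
Local Notation E := 'rV[R]_N.
Local Notation V0 := (essential phi).
Local Notation energy0 := (energy0 phi a).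
Local Notation energym := (energym phi a rho).
Local Notation energy := (energy phi a rho).
Local Notation D := (energy_domain phi K a rho).
Local Notation harmonic_extension := (harmonic_extension phi K a rho).
Local Notation Hext := (Hext phi K a rho).
Local Notation Htilde := (Htilde phi K a rho).
Local Notation Ptilde := (Ptilde phi K a rho).
Local Notation Mtilde := (Mtilde phi K a rho).
Local Notation Mtilde_w := (Mtilde_w phi K a rho).
Local Notation oneK := (oneK K).
Local Notation dotH := (dotH phi a rho).
Implicit Types (f g h : E -> R) (x y z : E) (w : seq 'I_M).

Definition V0_mean f : R :=
  (\sum_(x <- fset_set V0) f x) / \sum_(x <- fset_set V0) 1.

Lemma V0_card_gt0 : 0 < \sum_(x <- fset_set V0) 1 :> R.
Proof.
have [v0 [_ [Vv0 _ _]]] := nf_r nf.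
rewrite (bigD1_seq v0) ?fset_uniq ?(V0_mem nf) //=.
by rewrite ltr_pwDl // sumr_ge0.
Qed.

Lemma oneK_in x : K x -> oneK x = 1.
Proof. by move=> Kx; rewrite /Defs.oneK indicE mem_set. Qed.

Lemma dotH_oneK f :
  dotH f oneK = (\sum_(x <- fset_set V0) f x) * \sum_(x <- fset_set V0) 1.
Proof.
have fV := essential_finite nf.
rewrite /Defs.dotH energyC (@energy_ext _ _ _ _ _ _ _ _ nf _ (cst 1)); last first.
  by move=> x /set_mem Kx; rewrite oneK_in.
rewrite (energy_cst _ _ nf) add0r !fsbig_finite //=; congr (_ * _).
rewrite big_seq [RHS]big_seq; apply: eq_bigr => x /(mem_V0 nf) Vx.
by rewrite oneK_in //; exact: (essential_K nf).
Qed.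

Lemma PtildeE f : Ptilde f = fun x => patch (cst 0) K f x - V0_mean f * oneK x.
Proof.
apply/funext => x; rewrite /Defs.Ptilde !dotH_oneK.
have -> : \sum_(x <- fset_set V0) oneK x = \sum_(x <- fset_set V0) 1.
  rewrite big_seq [RHS]big_seq; apply: eq_bigr => y /(mem_V0 nf) Vy.
  by rewrite oneK_in //; exact: (essential_K nf).
have -> : \sum_(x <- fset_set V0) patch (cst 0) K f x = \sum_(x <- fset_set V0) f x.
  rewrite big_seq [RHS]big_seq; apply: eq_bigr => y /(mem_V0 nf) Vy.
  by rewrite patchT // inE; exact: (essential_K nf).
congr (_ - _ * _); rewrite /V0_mean; field.
by rewrite gt_eqF ?V0_card_gt0.
Qed.

Lemma Ptilde_in f x : K x -> Ptilde f x = f x - V0_mean f.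
Proof. by move=> Kx; rewrite PtildeE patchT ?inE // oneK_in // mulr1. Qed.

(** Constants have no energy, so that the projection along them is subtraction of
    the mean over the boundary. *)
Lemma Ptilde_affine f : {in K, Ptilde f =1 fun x => 1 * f x + cst (- V0_mean f) x}.
Proof. by move=> x /set_mem Kx; rewrite Ptilde_in // mul1r. Qed.

Lemma energy_shift f c : energy (fun x => 1 * f x + cst c x) (fun x => 1 * f x + cst c x)
  = energy f f.
Proof.
rewrite /Defs.energy; congr (limn _); apply/funext => m.
by rewrite (energym_sqr _ _ nf) (energymC _ _ _ m f) !(energym_cst _ _ nf); ring.
Qed.

Lemma energy_Ptilde f : energy (Ptilde f) (Ptilde f) = energy f f.
Proof.
rewrite (energy_ext _ _ nf _ (@Ptilde_affine f)) energyC.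
by rewrite (energy_ext _ _ nf _ (@Ptilde_affine f)) energy_shift.
Qed.

Lemma Ptilde_energy_domain f : D f -> D (Ptilde f).
Proof.
move=> Df; apply: (energy_domain_ext nf (f := fun x => 1 * f x + cst (- V0_mean f) x)).
  by move=> x Kx; rewrite Ptilde_affine.
by apply: (energy_domain_lin nf hs) => //; exact: (energy_domain_cst _ _ nf).
Qed.

(** Shifting by a constant changes neither energies nor minimizers. *)
Lemma Ptilde_Htilde f h : harmonic_extension f h -> Htilde (Ptilde h).
Proof.
move=> [Dh hV h0 hmin]; split; last first.
  rewrite dotH_oneK; apply/eqP; rewrite mulf_eq0; apply/orP; left; apply/eqP.
  transitivity (\sum_(x <- fset_set V0) h x - V0_mean h * \sum_(x <- fset_set V0) 1).
    rewrite mulr_sumr -sumrB big_seq [RHS]big_seq; apply: eq_bigr => x /(mem_V0 nf) Vx.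
    by rewrite Ptilde_in ?mulr1 //; exact: (essential_K nf).
  by rewrite /V0_mean divfK ?subrr // gt_eqF ?V0_card_gt0.
split => // [|x Kx|g Dg gV]; first exact: Ptilde_energy_domain.
  by rewrite PtildeE patchC ?inE // /Defs.oneK indicE memNset //= mulr0 subr0.
rewrite energy_Ptilde -(energy_shift g (V0_mean h)); apply: hmin.
  by apply: (energy_domain_lin nf hs) => //; exact: (energy_domain_cst _ _ nf).
move=> x Vx; rewrite gV // Ptilde_in; last exact: (essential_K nf).
by rewrite mul1r /cst subrK hV.
Qed.

Lemma Htilde_energy_domain h : Htilde h -> D h.
Proof. by move=> [[]]. Qed.

Lemma Ptilde_sum n (c : 'I_n -> R) (h : 'I_n -> E -> R) :
  Ptilde (fun x => \sum_k c k * h k x) = fun x => \sum_k c k * Ptilde (h k) x.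
Proof.
apply/funext => x; rewrite PtildeE; under [RHS]eq_bigr do rewrite PtildeE mulrBr.
rewrite sumrB; congr (_ - _).
  rewrite /patch; case: ifP => // _; by rewrite big1 // => k _; rewrite mulr0.
rewrite /V0_mean exchange_big /= !mulr_suml; apply: eq_bigr => k _.
by rewrite -mulr_sumr !mulrA.
Qed.

Lemma Mtilde_w_sum w n (c : 'I_n -> R) (h : 'I_n -> E -> R) :
  Mtilde_w w (fun x => \sum_k c k * h k x) = fun x => \sum_k c k * Mtilde_w w (h k) x.
Proof.
elim: w h => // i w IH h; rewrite /Defs.Mtilde_w /=.
rewrite -[RHS](IH (fun k => Mtilde i (h k))); congr (foldl _ _ w).
exact: (Ptilde_sum c (fun k => h k \o phi i)).
Qed.

Lemma energy_domain_sum n (c : 'I_n -> R) (h : 'I_n -> E -> R) : (forall k, D (h k)) ->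
  D (fun x => \sum_k c k * h k x).
Proof.
move=> Dh; suff : forall s : seq 'I_n, D (fun x => \sum_(k <- s) c k * h k x) by apply.
elim=> [|k s IH].
  by under eq_fun do rewrite big_nil; exact: (energy_domain_cst _ _ nf).
by under eq_fun do rewrite big_cons; exact: (energy_domain_lin nf hs).
Qed.

Lemma energy_sumr n (c : 'I_n -> R) (h : 'I_n -> E -> R) f : D f -> (forall k, D (h k)) ->
  energy f (fun x => \sum_k c k * h k x) = \sum_k c k * energy f (h k).
Proof.
move=> Df Dh.
suff : forall s : seq 'I_n, D (fun x => \sum_(k <- s) c k * h k x) /\
    energy f (fun x => \sum_(k <- s) c k * h k x) = \sum_(k <- s) c k * energy f (h k).
  by move=> /(_ (index_enum 'I_n))[].
elim=> [|k s [IH1 IH2]].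
  under eq_fun do rewrite big_nil; rewrite big_nil energyC (energy_cst _ _ nf).
  by split => //; exact: (energy_domain_cst _ _ nf).
under eq_fun do rewrite big_cons; split; first exact: (energy_domain_lin nf hs).
by rewrite big_cons energyC (energy_lin nf hs) // !(energyC _ _ _ _ f) IH2.
Qed.

Context (nd : nondegenerate_structure phi K a rho).
Context {n : nat} (e : 'I_n -> E -> R) (he : orthonormal_basis phi K a rho e).
Local Notation Mmx := (Mmx phi K a rho e).
Local Notation coordH := (coordH phi a rho e).

Definition norm2 (v : 'cV[R]_n) : R := (v^T *m v) 0 0.

Lemma norm2E v : norm2 v = \sum_k v k 0 ^+ 2.
Proof. by rewrite /norm2 mxE; apply: eq_bigr => k _; rewrite mxE expr2. Qed.

Lemma basis_energy_domain k : D (e k).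
Proof. by have [h _ _] := he; exact: Htilde_energy_domain. Qed.

Lemma energy_basis_sum k (c : 'I_n -> R) : energy (e k) (fun x => \sum_l c l * e l x) = c k.
Proof.
have [_ ho _] := he; rewrite energy_sumr; [|exact: basis_energy_domain|exact: basis_energy_domain].
rewrite (bigD1 k) //= ho eqxx mulr1 big1 ?addr0 // => l lk.
by rewrite ho eq_sym (negbTE lk) mulr0.
Qed.

Lemma Htilde_coord h : Htilde h -> h = fun x => \sum_k energy (e k) h * e k x.
Proof.
move=> Hh; have [_ _ hspan] := he; have [c hc] := hspan _ Hh.
have {}hc : h = fun x => \sum_k c k * e k x by apply/funext.
by rewrite {1}hc; apply/funext => x; apply: eq_bigr => k _; rewrite hc energy_basis_sum.
Qed.

Lemma energy_combination (v : 'cV[R]_n) :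
  energy (fun x => \sum_k v k 0 * e k x) (fun x => \sum_k v k 0 * e k x) = norm2 v.
Proof.
rewrite energy_sumr ?norm2E; [|by apply: energy_domain_sum; exact: basis_energy_domain|exact: basis_energy_domain].
by apply: eq_bigr => k _; rewrite energyC energy_basis_sum expr2.
Qed.

Lemma norm2_coordH h : Htilde h -> norm2 (coordH h) = energy h h.
Proof.
move=> Hh; rewrite -energy_combination.
suff -> : (fun x => \sum_k coordH h k 0 * e k x) = h by [].
by rewrite [RHS](Htilde_coord Hh); apply/funext => x; apply: eq_bigr => k _; rewrite mxE.
Qed.

Lemma Mtilde_Htilde i h : Htilde h -> Htilde (Mtilde i h).
Proof. by move=> Hh; have [ + _ _] := nd i; apply. Qed.

Lemma Mtilde_w_rcons w i h : Mtilde_w (rcons w i) h = Mtilde i (Mtilde_w w h).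
Proof. by rewrite /Defs.Mtilde_w foldl_rcons. Qed.

Lemma Mtilde_w_Htilde w h : Htilde h -> Htilde (Mtilde_w w h).
Proof.
move=> Hh; elim/last_ind: w => // w i IH; rewrite Mtilde_w_rcons.
exact: Mtilde_Htilde.
Qed.

Lemma Mtilde_w_basis w l : Mtilde_w w (e l) = fun x => \sum_k Mmx w k l * e k x.
Proof.
have [hH _ _] := he; rewrite [LHS](Htilde_coord (Mtilde_w_Htilde w (hH l))).
by apply/funext => x; apply: eq_bigr => k _; rewrite mxE.
Qed.

Lemma Mtilde_w_combination w (v : 'cV[R]_n) :
  Mtilde_w w (fun x => \sum_l v l 0 * e l x) = fun x => \sum_k (Mmx w *m v) k 0 * e k x.
Proof.
rewrite Mtilde_w_sum; apply/funext => x.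
under eq_bigr => l _ do rewrite Mtilde_w_basis mulr_sumr.
rewrite exchange_big; apply: eq_bigr => k _; rewrite mxE mulr_suml.
by apply: eq_bigr => l _; rewrite mulrA (mulrC (v l 0)).
Qed.

Lemma Mmx_nil : Mmx [::] = 1%:M.
Proof. by have [_ ho _] := he; apply/matrixP => k l; rewrite !mxE ho. Qed.

(** The last letter acts last, hence on the left of the matrix product. *)
Lemma Mmx_rcons w i : Mmx (rcons w i) = Mmx [:: i] *m Mmx w.
Proof.
apply/matrixP => k l; rewrite mxE Mtilde_w_rcons Mtilde_w_basis.
have := @Mtilde_w_combination [:: i] (col l (Mmx w)).
under eq_fun do under eq_bigr do rewrite mxE.
rewrite /Defs.Mtilde_w /= => ->; rewrite energy_basis_sum !mxE.
by apply: eq_bigr => j _; rewrite [col _ _ _ _]mxE.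
Qed.

(** The coordinates of preimages of the basis under the surjective [Mtilde i] form
    a right inverse. *)
Lemma Mmx1_unit i : Mmx [:: i] \in unitmx.
Proof.
have [hH ho _] := he.
have /choice[h hh] l : exists h, Htilde h /\ Mtilde i h = e l.
  have [_ _ surj] := nd i; have [h Hh eh] := surj _ (hH l); by exists h.
suff /mulmx1_unit[] : Mmx [:: i] *m (\matrix_(j, l) energy (e j) (h l)) = 1%:M by [].
apply/matrixP => k l; rewrite mxE [RHS]mxE -ho -(hh l).2.
have := @Mtilde_w_combination [:: i] (coordH (h l)).
rewrite /Defs.Mtilde_w /=; under [X in Mtilde i X]eq_fun do under eq_bigr do rewrite mxE.
rewrite -(Htilde_coord (hh l).1) => ->; rewrite energy_basis_sum mxE.
by apply: eq_bigr => j _; rewrite !mxE.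
Qed.

Lemma Mmx_unit w : Mmx w \in unitmx.
Proof.
elim/last_ind: w => [|w i IH]; first by rewrite Mmx_nil unitmx1.
by rewrite Mmx_rcons unitmx_mul Mmx1_unit.
Qed.

(** Self-similarity of the energy, read in coordinates. *)
Lemma Mmx_isometry v : rho * \sum_(i < M) norm2 (Mmx [:: i] *m v) = norm2 v.
Proof.
pose h := fun x => \sum_k v k 0 * e k x.
have Dh : D h by apply: energy_domain_sum; exact: basis_energy_domain.
rewrite -[RHS]energy_combination -/h (energy_selfsimilar nf hs Dh Dh).
congr (_ * _); apply: eq_bigr => i _.
by rewrite -energy_combination -Mtilde_w_combination -/h energy_Ptilde.
Qed.

(** The projected extension has the energy of the extension, which dominates its
    level-0 energy since [energym] is nondecreasing in the level. *)
Lemma norm2_Hext g : D g -> energy0 g g <= norm2 (coordH (Ptilde (Hext g))).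
Proof.
move=> Dg; have hx := Hext_spec nf hs Dg.
rewrite norm2_coordH ?energy_Ptilde; last exact: Ptilde_Htilde hx.
have [Dh hV _ _] := hx; apply: le_trans (energym_le_energy nf hs 0 Dh).
rewrite energym0 !(energy0E _ nf) ler_pM2l ?invr_gt0 //.
rewrite le_eqVlt; apply/orP; left; apply/eqP.
rewrite big_seq [RHS]big_seq; apply: eq_bigr => x /(mem_V0 nf) Vx.
rewrite big_seq [RHS]big_seq; apply: eq_bigr => y /(mem_V0 nf) Vy.
by rewrite !hV.
Qed.

Lemma qform_gram (A : 'M[R]_n) F : qform (A^T *m A) F = norm2 (A *m F).
Proof. by rewrite /qform /norm2 trmx_mul !mulmxA. Qed.

End HarmonicMatrices.

(** * Kusuoka measure and gradient *)

Section QuadraticForms.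
Context {R : realType} {n : nat}.
Implicit Types (Z A : 'M[R]_n) (F G H : 'cV[R]_n).

Lemma qformE Z F : qform Z F = \sum_j (\sum_i F i 0 * Z i j) * F j 0.
Proof.
rewrite /qform mxE; apply: eq_bigr => j _; rewrite mxE; congr (_ * _).
by apply: eq_bigr => i _; rewrite mxE.
Qed.

Lemma qformZ c Z F : qform (c *: Z) F = c * qform Z F.
Proof. by rewrite /qform -scalemxAr -scalemxAl mxE. Qed.

Lemma gram_trace A : \tr (A^T *m A) = \sum_k \sum_l A l k ^+ 2.
Proof.
apply: eq_bigr => k _; rewrite mxE; apply: eq_bigr => l _.
by rewrite mxE expr2.
Qed.

Lemma gram_trace_ge0 A : 0 <= \tr (A^T *m A).
Proof. by rewrite gram_trace; do 2!(apply: sumr_ge0 => ? _); exact: sqr_ge0. Qed.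

(** The trace is the sum of all squared entries, so this bounds the entries of
    the normalized matrices [Zm] by 1. *)
Lemma gram_entry_le A i j : `|(A^T *m A) i j| <= \tr (A^T *m A).
Proof.
have col_le k : \sum_l A l k ^+ 2 <= \tr (A^T *m A).
  rewrite gram_trace [leRHS](bigD1 k) //= lerDl.
  by do 2!(apply: sumr_ge0 => ? _); exact: sqr_ge0.
rewrite mxE; apply: le_trans (ler_norm_sum _ _ _) _.
apply: (@le_trans _ _ (\sum_l (2^-1 * A l i ^+ 2 + 2^-1 * A l j ^+ 2))).
  apply: ler_sum => l _; rewrite mxE normrM -[A l i ^+ 2]real_normK ?num_real //.
  rewrite -[A l j ^+ 2]real_normK ?num_real //.
  have := sqr_ge0 (`|A l i| - `|A l j|); lra.
rewrite big_split /= -!mulr_sumr; have := col_le i; have := col_le j; lra.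
Qed.

Lemma norm2_ge0 F : 0 <= norm2 F.
Proof. by rewrite norm2E; apply: sumr_ge0 => k _; exact: sqr_ge0. Qed.

Definition psd Z := forall F, 0 <= qform Z F.

(** Nonnegativity of the form at [c *: G - (F - G)] bounds the cross term. *)
Lemma qform_young Z F G (c : R) : psd Z -> 0 < c ->
  qform Z F <= (1 + c) * qform Z G + (1 + c^-1) * qform Z (F - G).
Proof.
move=> Z0 c0; have := Z0 (c *: G - (F - G)).
have bil (x y : R) U V : qform Z (x *: U + y *: V) = x ^+ 2 * qform Z U + y ^+ 2 * qform Z V +
    x * y * ((U^T *m Z *m V) 0 0 + (V^T *m Z *m U) 0 0).
  rewrite /qform; have -> : (x *: U + y *: V)^T = x *: U^T + y *: V^T.
    by rewrite linearD /= !linearZ.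
  rewrite !mulmxDl !mulmxDr.
  rewrite -!(scalemxAl, scalemxAr) !mxE; ring.
have -> : c *: G - (F - G) = c *: G + (-1) *: (F - G) by rewrite scaleN1r.
have {2}-> : F = 1 *: G + 1 *: (F - G) by rewrite !scale1r addrC subrK.
rewrite !bil => h.
have ci : c^-1 * c = 1 by rewrite mulVf // gt_eqF.
rewrite -(ler_pM2l c0); have -> : c * ((1 + c) * qform Z G + (1 + c^-1) * qform Z (F - G)) =
  c * (1 + c) * qform Z G + (c + c^-1 * c) * qform Z (F - G) by ring.
by rewrite ci; lra.
Qed.

End QuadraticForms.

Section Kusuoka.
Context {R : realType} {N M : nat}.
Context (phi : 'I_M -> 'rV[R]_N -> 'rV[R]_N) (L : R) (K : set 'rV[R]_N).
Context (a : 'rV[R]_N -> 'rV[R]_N -> R) (rho : R).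
Context (nf : nested_fractal phi L K) (hs : harmonic_structure phi a rho).
Context (nd : nondegenerate_structure phi K a rho).
Context {n : nat} (e : 'I_n -> 'rV[R]_N -> R) (he : orthonormal_basis phi K a rho e).
Context (mu nu : {measure set (borelE R N) -> \bar R}).
Context (mu_norm : normalized_hausdorff (dim_hausdorff M L) K mu).
Context (hnu : kusuoka_measure phi K a rho e nu).
Context (Z : borelE R N -> 'M[R]_n) (hZ : is_Z phi K a rho e nu Z).
Local Notation T := (borelE R N).
Local Notation E := 'rV[R]_N.
Local Notation energym := (energym phi a rho).
Local Notation energy := (energy phi a rho).
Local Notation D := (energy_domain phi K a rho).
Local Notation Mmx := (Mmx phi K a rho e).
Local Notation Zm := (Zm phi K a rho e).
Local Notation Vinf := (Vinf phi).
Local Notation cell := (cell phi K).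
Implicit Types (w : seq 'I_M) (x : E).

Lemma borelE_set1 x : measurable ([set x] : set T).
Proof.
apply: borelE_closed; apply: compact_closed; first exact: norm_hausdorff.
exact: compact_set1.
Qed.

Lemma countable_singletons (S : set E) : countable S ->
  exists F : nat -> set E, S = \bigcup_k F k /\
    forall k, F k = set0 \/ exists x, F k = [set x].
Proof.
move=> /countable_injP[f finj]; exists (fun k => [set x | S x /\ f x = k]); split.
  by apply/seteqP; split => [x Sx|x [k _ []//]]; exists (f x).
move=> k; have [[x0 [Sx0 fx0]]|ne] := pselect (exists x, S x /\ f x = k).
  right; exists x0; apply/seteqP; split => [x /= [Sx fx]|x /= ->//].
  by apply: finj; rewrite ?inE // fx.
by left; apply/seteqP; split=> // x h; apply: ne; exists x.
Qed.

Lemma borelE_countable (S : set E) : countable S -> measurable (S : set T).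
Proof.
move=> /countable_singletons[F [-> hF]]; apply: bigcup_measurable => k _.
have [->|[x ->]] := hF k; [exact: measurable0|exact: borelE_set1].
Qed.

Lemma Vinf_negligible : nu.-negligible (Vinf : set T).
Proof.
have [_ nu1 _] := hnu.
have /countable_singletons[F [-> hF]] := Vinf_countable nf.
apply: negligible_bigcup => k; have [->|[x ->]] := hF k; first exact: negligible_set0.
by apply/negligibleP; [exact: borelE_set1|exact: nu1].
Qed.

(** Away from the countable set of vertices, having a given address means lying
    in a given cell. *)
Lemma address_measurable m (g : T -> R) :
  (forall x y, K x -> K y -> address phi K m x = address phi K m y -> g x = g y) ->
  measurable_fun (K : set T) g.
Proof.
move=> hg _ Y mY; pose C (t : m.-tuple 'I_M) := [set x | K x /\ address phi K m x = t].
have mC t : measurable (C t : set T).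
  rewrite (_ : C t = (cell t `\` Vinf) `|` (C t `&` Vinf)).
    apply: measurableU; last first.
      apply: borelE_countable; apply: (sub_countable _ (Vinf_countable nf)).
      by apply: subset_card_le => x [].
    apply: measurableD; first exact: (cell_measurable nf).
    exact: borelE_countable (Vinf_countable nf).
  have Ct x : cell t x -> ~ Vinf x -> C t x.
    move=> cx Vx; split; first exact: (cell_sub nf) cx.
    by have := address_cell nf mu_norm Vx cx; rewrite size_tuple.
  apply/seteqP; split => x; last by move=> [[/Ct h /h]|[]].
  move=> Cx; have [Vx|Vx] := pselect (Vinf x); [by right|left; split=> //].
  have [Kx ax] := Cx; have [w sw cw] := cell_exists nf m Kx.
  by have := address_cell nf mu_norm Vx cw; rewrite sw ax => ->.
rewrite (_ : _ `&` _ = \bigcup_(t : m.-tuple 'I_M) (C t `&` g @^-1` Y)); last first.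
  apply/seteqP; split => [x [Kx gx]|x [t _ [[Kx _] gx]]]; last by split.
  have sa : size (address phi K m x) = m.
    rewrite /address; case: xgetP => [w _ [] //|].
    by have [w sw cw] := cell_exists nf m Kx => /(_ w) [].
  by exists (tcast sa (in_tuple (address phi K m x))); rewrite // /C /= val_tcast.
apply: fin_bigcup_measurable => [|t _]; first exact: finite_finset.
have [[x0 [[Kx0 ax0] gx0]]|ne] := pselect (exists x, (C t `&` g @^-1` Y) x).
  rewrite (_ : _ `&` _ = C t); first exact: mC.
  apply/seteqP; split => x; first by case.
  move=> [Kx ax]; split=> //=; suff -> : g x = g x0 by [].
  by apply: hg => //; rewrite ax ax0.
rewrite (_ : _ `&` _ = set0) //; apply/seteqP; split=> // x h.
by apply: ne; exists x.
Qed.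

(** Everything that can go wrong, namely vertices (where addresses are
    ambiguous) and points where [Zm] does not converge, sits in one null set. *)
Lemma exceptional_set : exists A : set T,
  [/\ measurable A, nu A = 0%E, Vinf `<=` A &
      forall x, K x -> ~ A x -> (fun m => Zm m x) @ \oo --> Z x].
Proof.
have [_ Zae] := hZ; have [A [mA A0 AN]] := negligibleU Vinf_negligible Zae.
exists A; split => // [x Vx|x Kx nA]; first by apply: AN; left.
by apply: contrapT => h; apply/nA/AN; right => /(_ Kx).
Qed.

Context (A : set T) (mA : measurable A) (A0 : nu A = 0%E) (AV : Vinf `<=` A).
Context (AZ : forall x, K x -> ~ A x -> (fun m => Zm m x) @ \oo --> Z x).

(** Removing the exceptional set makes cells of one level disjoint. *)
Definition regular_cell w : set T := (cell w : set T) `\` A.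
Local Notation Dw := regular_cell.
Local Notation K' := ((K : set T) `\` A).

Lemma regular_cell_measurable w : measurable (Dw w).
Proof. by apply: measurableD => //; exact: (cell_measurable nf). Qed.

Lemma regular_measurable : measurable K'.
Proof. by apply: measurableD => //; exact: borelE_closed (K_closed nf). Qed.

Lemma regular_cell_sub w : Dw w `<=` K'.
Proof. by move=> x [cw nA]; split=> //; exact: (cell_sub nf) cw. Qed.

Lemma regular_cell_address w x : Dw w x -> address phi K (size w) x = w.
Proof. by move=> [cw nA]; apply: (address_cell nf mu_norm) => // /AV. Qed.

Lemma regular_cell_split w : Dw w = \big[setU/set0]_(i <- enum 'I_M) Dw (rcons w i).
Proof.
rewrite -bigcup_seq; apply/seteqP; split => x.
  by move=> [/(cell_split nf)[i ci] nA]; exists i => //=; rewrite mem_enum.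
by move=> [i _ [ci nA]]; split=> //; exact: (cell_rcons nf) ci.
Qed.

Lemma regular_cell_trivIset w :
  trivIset [set` enum 'I_M] (fun i => Dw (rcons w i)).
Proof.
move=> i j _ _ [x [/regular_cell_address + /regular_cell_address]].
by rewrite !size_rcons => -> /rcons_inj[].
Qed.

Lemma nu_regular_cell w :
  nu (Dw w) = (rho ^+ size w * \tr ((Mmx w)^T *m Mmx w))%:E.
Proof.
have [_ _ <-] := hnu; have mw := cell_measurable nf w.
rewrite /regular_cell.
have h := measureDI nu mw mA.
have n0 : nu ((cell w : set T) `&` A) = 0%E.
  by apply: subset_measure0 A0 => //; exact: measurableI.
by rewrite h [X in (_ + X)%E]n0 adde0.
Qed.

Lemma measurable_regular (g : T -> R) : measurable_fun (K : set T) g -> measurable_fun K' g.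
Proof.
apply: measurable_funS; first exact: borelE_closed (K_closed nf).
by move=> x [].
Qed.

Lemma integral_regular (B : set T) (g : T -> \bar R) : measurable B ->
  measurable_fun B g -> (\int[nu]_(x in B) g x = \int[nu]_(x in B `\` A) g x)%E.
Proof.
move=> mB mg; rewrite integralE [RHS]integralE; congr (_ - _)%E;
  apply: ge0_negligible_integral => //.
  exact: measurable_funepos.
exact: measurable_funeneg.
Qed.

(** The refinements of a regular cell by one letter partition it. *)
Lemma integral_regular_cell_split w (g : T -> R) : measurable_fun K' g ->
  (forall x, K' x -> 0 <= g x) ->
  (\int[nu]_(x in Dw w) (g x)%:E =
   \sum_(i < M) \int[nu]_(x in Dw (rcons w i)) (g x)%:E)%E.
Proof.
move=> mg g0; rewrite {1}regular_cell_split ge0_integral_bigsetU.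
- by rewrite big_enum.
- by move=> i; exact: regular_cell_measurable.
- exact: enum_uniq.
- exact: regular_cell_trivIset.
- apply/measurable_EFinP; rewrite -regular_cell_split.
  apply: (measurable_funS regular_measurable (@regular_cell_sub w)) mg.
- by move=> x; rewrite -regular_cell_split => /regular_cell_sub/g0; rewrite lee_fin.
Qed.

Lemma qform_measurable (B : set T) (W : T -> 'M[R]_n) (F : T -> 'cV[R]_n) :
  (forall i j, measurable_fun B (fun x => W x i j)) ->
  (forall i, measurable_fun B (fun x => F x i 0)) ->
  measurable_fun B (fun x => qform (W x) (F x)).
Proof.
move=> mW mF; under eq_fun do rewrite qformE.
apply: measurable_sum => j; apply: measurable_funM => //.
by apply: measurable_sum => i; exact: measurable_funM.
Qed.

Lemma Zm_regular w x : Dw w x ->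
  Zm (size w) x = (\tr ((Mmx w)^T *m Mmx w))^-1 *: ((Mmx w)^T *m Mmx w).
Proof. by move=> Dx; rewrite /Defs.Zm regular_cell_address. Qed.

Lemma psd_Zm m x : psd (Zm m x).
Proof.
move=> F; rewrite /Defs.Zm qformZ qform_gram mulr_ge0 ?norm2_ge0 //.
by rewrite invr_ge0 gram_trace_ge0.
Qed.

Lemma Zm_entry_le m x i j : `|Zm m x i j| <= 1.
Proof.
rewrite /Defs.Zm mxE normrM ger0_norm ?invr_ge0 ?gram_trace_ge0 //.
set A' := Mmx _; have := gram_entry_le A' i j.
have := gram_trace_ge0 A'; rewrite le_eqVlt => /predU1P[<-|t0]; first by rewrite invr0 mul0r.
by rewrite ler_pdivrMl // mulr1.
Qed.

Lemma qform_Zm_le m x F :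
  `|qform (Zm m x) F| <= \sum_j \sum_i `|F i 0| * `|F j 0|.
Proof.
rewrite qformE; apply: le_trans (ler_norm_sum _ _ _) _; apply: ler_sum => j _.
rewrite normrM -mulr_suml ler_wpM2r //; apply: le_trans (ler_norm_sum _ _ _) _.
by apply: ler_sum => i _; rewrite normrM ler_piMr // Zm_entry_le.
Qed.

Lemma qform_Z_cvg x F : K' x -> qform (Zm m x) F @[m --> \oo] --> qform (Z x) F.
Proof.
move=> [Kx nA]; rewrite qformE; under eq_fun do rewrite qformE.
apply: cvg_big => [|j _]; first exact: add_continuous.
apply: cvgM; last exact: cvg_cst.
apply: cvg_big => [|i _]; first exact: add_continuous.
apply: cvgM; first exact: cvg_cst.
apply: (@cvg_comp _ _ _ (fun m => Zm m x) (fun A : 'M[R]_n => A i j)).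
  exact: AZ.
exact: coord_continuous.
Qed.

Lemma psd_Z x : K' x -> psd (Z x).
Proof.
move=> Kx F; have h := @qform_Z_cvg x F Kx.
rewrite -oppr_le0; apply: (cvg_le_bound (cvgN h)).
by apply: nearW => m; rewrite oppr_le0 psd_Zm.
Qed.

Lemma Zm_measurable m i j : measurable_fun (K : set T) (fun x : T => Zm m x i j).
Proof. by apply: (@address_measurable m) => x y _ _ h; rewrite /Defs.Zm h. Qed.

Lemma qform_regular_measurable (W : T -> 'M[R]_n) (F : T -> 'cV[R]_n) :
  (forall i j, measurable_fun (K : set T) (fun x => W x i j)) ->
  (forall i, measurable_fun (K : set T) (fun x => F x i 0)) ->
  measurable_fun K' (fun x => qform (W x) (F x)).
Proof. by move=> mW mF; apply: measurable_regular; exact: qform_measurable. Qed.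

(** Consistency of the weights of [nu]: by the isometry identity, averaging [Zm]
    over a cell gives the same matrix at every finer level. *)
Lemma integral_Zm k w F :
  (\int[nu]_(x in Dw w) (qform (Zm (size w + k) x) F)%:E =
   (rho ^+ size w * norm2 (Mmx w *m F))%:E)%E.
Proof.
elim: k w => [|k IH] w.
  rewrite addn0 (eq_integral
    (cst ((\tr ((Mmx w)^T *m Mmx w))^-1 * norm2 (Mmx w *m F))%:E)); last first.
    by move=> x /set_mem Dx; rewrite Zm_regular // qformZ qform_gram.
  rewrite integral_cst; last exact: regular_cell_measurable.
  rewrite /= nu_regular_cell -EFinM; congr EFin.
  have := gram_trace_ge0 (Mmx w); rewrite le_eqVlt => /predU1P[t0|t0]; last first.
    by field; rewrite gt_eqF.
  have g0 : (Mmx w)^T *m Mmx w = 0.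
    apply/matrixP => i j; rewrite [RHS]mxE; apply/eqP; rewrite -normr_le0.
    by rewrite [leRHS]t0 gram_entry_le.
  by rewrite -qform_gram g0 /qform mulmx0 mul0mx mxE mulr0 mul0r mulr0.
rewrite integral_regular_cell_split.
- under eq_bigr => i _.
    have -> : (size w + k.+1 = size (rcons w i) + k)%N by rewrite size_rcons addSnnS.
    rewrite IH size_rcons (Mmx_rcons nf hs nd he) -mulmxA exprSr -mulrA; over.
  by rewrite sumEFin -!mulr_sumr (Mmx_isometry nf hs nd he).
- apply: qform_regular_measurable => [i j|i]; [exact: Zm_measurable|exact: measurable_cst].
- by move=> x _; exact: psd_Zm.
Qed.

(** Dominated convergence: the forms given by [Zm] are bounded on each vector, and
    their integrals do not depend on the level. *)
Lemma integral_Z w F :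
  (\int[nu]_(x in Dw w) (qform (Z x) F)%:E = (rho ^+ size w * norm2 (Mmx w *m F))%:E)%E.
Proof.
have mD := regular_cell_measurable w; have DK := @regular_cell_sub w.
pose B := \sum_j \sum_i `|F i 0| * `|F j 0|.
pose fk k (x : T) := (qform (Zm (size w + k) x) F)%:E.
have [|||||_ _] := @dominated_convergence _ T R nu _ mD fk
  (fun x => (qform (Z x) F)%:E) (cst B%:E).
- move=> k; apply/measurable_EFinP.
  apply: (measurable_funS regular_measurable DK); apply: qform_regular_measurable.
    by move=> i j; exact: Zm_measurable.
  by move=> i; exact: measurable_cst.
- apply/measurable_EFinP.
  apply: (measurable_funS regular_measurable DK); apply: qform_regular_measurable.
    by move=> i j; exact: hZ.1.
  by move=> i; exact: measurable_cst.
- apply: aeW => x /DK Kx; apply: cvg_EFin; first exact: nearW.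
  have := @qform_Z_cvg x F Kx; rewrite -(cvg_shiftn (size w)).
  by under eq_fun do rewrite addnC.
- apply/integrableP; split; first exact: measurable_cst.
  by rewrite integral_cst // nu_regular_cell -EFinM ltry.
- by apply: aeW => x k _; rewrite /fk abse_EFin lee_fin qform_Zm_le.
rewrite /fk; under [X in X @ _]eq_fun do rewrite integral_Zm.
by move=> h; rewrite -(cvg_lim _ h) // lim_cst.
Qed.

Context (f : E -> R) (Df : D f).
Local Notation nabla_m := (nabla_m phi K a rho e).

Lemma nabla_m_measurable m i : measurable_fun (K : set T) (fun x : T => nabla_m m f x i 0).
Proof. by apply: (@address_measurable m) => x y _ _ h; rewrite /Defs.nabla_m h. Qed.

(** On a cell of its own level [nabla_m] is constant and undoes the matrix of the
    cell, so that the integral is the energy of the harmonic extension, which is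
    at least the energy of its boundary values. *)
Lemma integral_nabla_ge k w :
  ((rho ^+ size w * energym k (f \o phi_w phi w) (f \o phi_w phi w))%:E <=
   \int[nu]_(x in Dw w) (qform (Z x) (nabla_m (size w + k) f x))%:E)%E.
Proof.
elim: k w => [|k IH] w.
  pose F := invmx (Mmx w) *m
    coordH phi a rho e (Ptilde phi K a rho (Hext phi K a rho (f \o phi_w phi w))).
  rewrite addn0 (eq_integral (fun x : T => (qform (Z x) F)%:E)); last first.
    by move=> x /set_mem Dx; rewrite /Defs.nabla_m regular_cell_address.
  rewrite integral_Z lee_fin ler_wpM2l ?exprn_ge0 ?(rho_ge0 hs) //.
  rewrite /F mulKVmx ?(Mmx_unit nf hs nd he) // energym0.
  by apply: (norm2_Hext nf hs he); exact: (energy_domain_comp nf hs).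
rewrite integral_regular_cell_split.
- rewrite energymS mulrA -exprSr mulr_sumr -sumEFin; apply: lee_sum => i _.
  have -> : (size w + k.+1 = size (rcons w i) + k)%N by rewrite size_rcons addSnnS.
  by have := IH (rcons w i); rewrite size_rcons phi_w_rcons.
- by apply: qform_regular_measurable => [i j|i]; [exact: hZ.1|exact: nabla_m_measurable].
- by move=> x /psd_Z; apply.
Qed.

Context (gradf : T -> 'cV[R]_n) (hg : is_gradient phi K a rho e nu Z f gradf).

Lemma gradient_error_measurable m i :
  measurable_fun (K : set T) (fun x : T => (nabla_m m f x - gradf x) i 0).
Proof.
rewrite (_ : (fun x => _) = fun x : T => nabla_m m f x i 0 - gradf x i 0); last first.
  by apply/funext => x; rewrite !mxE.
apply: measurable_funB; last exact: hg.1.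
exact: nabla_m_measurable.
Qed.

Lemma gradient_approx (d : R) : 0 < d -> exists m0, forall m, (m0 <= m)%N ->
  (\int[nu]_(x in K') (qform (Z x) (nabla_m m f x - gradf x))%:E <= d%:E)%E.
Proof.
move=> d0; have [_ /fine_cvgP[/= fz hz]] := hg.
have d0' : 0 < Num.sqrt d by rewrite sqrtr_gt0.
have [m0 _ hm0] := filterI fz (cvgr_lt _ hz _ d0').
exists m0 => m /hm0 /= [fin lt]; rewrite -integral_regular.
- rewrite -lee_sqrt ?lee_fin ?(ltW d0) // /Zseminorm in fin lt *.
  by rewrite -(fineK fin) lee_fin ltW.
- exact: borelE_closed (K_closed nf).
- apply/measurable_EFinP; apply: qform_measurable => [|i]; first exact: hZ.1.
  exact: gradient_error_measurable.
Qed.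

(** The lower bound for [nabla_m] passes to its limit: by [qform_young] replacing
    [nabla_m] by [gradf] costs a factor [1 + c] and an error that is small for
    large [m], and [c] is arbitrary. *)
Lemma integral_gradient_ge w :
  ((rho ^+ size w * energy (f \o phi_w phi w) (f \o phi_w phi w))%:E <=
   \int[nu]_(x in Dw w) (qform (Z x) (gradf x))%:E)%E.
Proof.
have mD := regular_cell_measurable w; have DK := @regular_cell_sub w.
have mK (g : T -> R) : measurable_fun K' g -> measurable_fun (Dw w) (EFin \o g).
  by move=> mg; apply/measurable_EFinP; exact: (measurable_funS regular_measurable DK).
have mG : measurable_fun K' (fun x => qform (Z x) (gradf x)).
  by apply: qform_regular_measurable; [exact: hZ.1|exact: hg.1].
have mH m : measurable_fun K' (fun x => qform (Z x) (nabla_m m f x - gradf x)).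
  apply: qform_regular_measurable => [|i]; first exact: hZ.1.
  exact: gradient_error_measurable.
have mN m : measurable_fun K' (fun x => qform (Z x) (nabla_m m f x)).
  by apply: qform_regular_measurable; [exact: hZ.1|move=> i; exact: (nabla_m_measurable m i)].
have I0 : (0 <= \int[nu]_(x in Dw w) (qform (Z x) (gradf x))%:E)%E.
  by apply: integral_ge0 => x /DK/psd_Z; rewrite lee_fin; apply.
case EI : (\int[nu]_(x in Dw w) (qform (Z x) (gradf x))%:E)%E I0 => [r||] //;
  last by move=> _; rewrite leey.
rewrite !lee_fin => r0.
have key k (eps : R) : 0 < eps ->
    rho ^+ size w * energym k (f \o phi_w phi w) (f \o phi_w phi w) <= r + eps.
  (* Half of [eps] goes to [c * r], the other half to [(1 + c^-1) * d]. *)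
  move=> eps0; pose c := eps / 2 / (r + 1); pose d := eps / 2 / (1 + c^-1).
  have c0 : 0 < c by rewrite !divr_gt0 // ltr_wpDl.
  have ci0 : 0 < 1 + c^-1 by rewrite addr_gt0 ?invr_gt0.
  have d0 : 0 < d by rewrite !divr_gt0.
  have [m0 hm0] := gradient_approx d0.
  have cr : c * r <= eps / 2.
    rewrite /c mulrAC ler_pdivrMr ?ltr_wpDl // ler_pM2l ?divr_gt0 //; lra.
  suff : ((rho ^+ size w * energym k (f \o phi_w phi w) (f \o phi_w phi w))%:E <=
          (1 + c)%:E * r%:E + (1 + c^-1)%:E * d%:E)%E.
    rewrite -!EFinM -EFinD lee_fin => /le_trans; apply.
    by rewrite /d [_ * (eps / 2 / _)]mulrC divfK ?gt_eqF //; lra.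
  apply: (@le_trans _ _ (rho ^+ size w *
    energym (k + m0) (f \o phi_w phi w) (f \o phi_w phi w))%:E).
    rewrite lee_fin ler_wpM2l ?exprn_ge0 ?(rho_ge0 hs) //.
    by apply: (energym_nondecreasing nf hs); exact: leq_addr.
  apply: le_trans (integral_nabla_ge _ _) _.
  set m := (size w + (k + m0))%N.
  apply: (@le_trans _ _ (\int[nu]_(x in Dw w) ((1 + c)%:E * (qform (Z x) (gradf x))%:E +
     (1 + c^-1)%:E * (qform (Z x) (nabla_m m f x - gradf x))%:E))%E).
    apply: ge0_le_integral => //.
    - by move=> x /DK/psd_Z; rewrite lee_fin; apply.
    - exact: (mK _ (mN m)).
    - apply: emeasurable_funD; apply: measurable_funeM; first exact: (mK _ mG).
      exact: (mK _ (mH m)).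
    - by move=> x /DK/psd_Z p; rewrite -!EFinM -EFinD lee_fin qform_young.
  have c1 : 0 <= 1 + c by rewrite addr_ge0 // ltW.
  rewrite ge0_integralD //; first last.
  - by apply: measurable_funeM; exact: (mK _ (mH m)).
  - by move=> x /DK/psd_Z p; rewrite -EFinM lee_fin mulr_ge0 // ltW.
  - by apply: measurable_funeM; exact: (mK _ mG).
  - by move=> x /DK/psd_Z p; rewrite -EFinM lee_fin mulr_ge0.
  rewrite ge0_integralZl_EFin //; first last.
  - exact: (mK _ mG).
  - by move=> x /DK/psd_Z p; rewrite lee_fin.
  rewrite ge0_integralZl_EFin ?(ltW ci0) //; first last.
  - exact: (mK _ (mH m)).
  - by move=> x /DK/psd_Z p; rewrite lee_fin.
  rewrite EI leeD2l // lee_pmul2l // ?lte_fin //.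
  apply: le_trans (hm0 m _); last by rewrite /m; lia.
  apply: ge0_subset_integral => //; first exact: regular_measurable.
    by apply/measurable_EFinP; exact: mH.
  by move=> x /psd_Z p; rewrite lee_fin.
have rw : 0 < rho ^+ size w by rewrite exprn_gt0 ?(rho_gt0 hs).
rewrite -ler_pdivlMl //; apply: (energy_le nf hs); first exact: (energy_domain_comp nf hs).
by move=> k; rewrite ler_pdivlMl //; apply/ler_addgt0Pr => eps; exact: key.
Qed.

Lemma integral_gradient_superset_ge w (S : set T) :
  measurable S -> cell w `<=` S -> S `<=` K ->
  ((rho ^+ size w * energy (f \o phi_w phi w) (f \o phi_w phi w))%:E <=
   \int[nu]_(x in S) (qform (Z x) (gradf x))%:E)%E.
Proof.
move=> mS cS SK; have mKm : measurable (K : set T) by exact: borelE_closed (K_closed nf).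
have mq : measurable_fun S (fun x => (qform (Z x) (gradf x))%:E).
  apply/measurable_EFinP; apply: (measurable_funS mKm SK).
  by apply: qform_measurable; [exact: hZ.1|exact: hg.1].
rewrite integral_regular //; apply: le_trans (integral_gradient_ge w) _.
apply: ge0_subset_integral.
- exact: regular_cell_measurable.
- exact: measurableD.
- by apply: measurable_funS mq => // x [].
- by move=> x [/SK Kx nA]; rewrite lee_fin; exact: psd_Z.
- by move=> x [/cS].
Qed.

End Kusuoka.

(** * The pointwise estimate *)

Lemma powR_exprn {R : realType} (x r : R) n : 0 <= x -> (x ^+ n) `^ r = (x `^ r) ^+ n.
Proof.
move=> x0; elim: n => [|n IH]; first by rewrite !expr0 powR1.
by rewrite !exprS powRM ?exprn_ge0 // IH.
Qed.

Section Volumes.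
Context {R : realType} {N M : nat}.
Context (phi : 'I_M -> 'rV[R]_N -> 'rV[R]_N) (L : R) (K : set 'rV[R]_N).
Context (a : 'rV[R]_N -> 'rV[R]_N -> R) (rho : R).
Context (nf : nested_fractal phi L K) (hs : harmonic_structure phi a rho).
Local Notation dw := (walk_dim M L rho).

Lemma Mrho_gt1 : 1 < M%:R * rho.
Proof.
have := M_gt1 nf; have := rho_gt1 hs => r1 M1.
by rewrite -[ltLHS]mulr1 ltr_pM.
Qed.

Lemma ratio_powR_walk_dim : L^-1 `^ dw = (M%:R * rho)^-1.
Proof.
have L0 : 0 < L by exact: lt_trans ltr01 (nf_L nf).
rewrite /powR gt_eqF ?invr_gt0 // lnV ?posrE // mulrN /walk_dim.
rewrite divfK ?gt_eqF ?(lnL_gt0 nf) // expRN lnK // posrE.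
exact: lt_trans ltr01 Mrho_gt1.
Qed.

Lemma walk_dim_ge0 : 0 <= dw.
Proof. by rewrite divr_ge0 // ltW ?ln_gt0 ?Mrho_gt1 ?(nf_L nf). Qed.

(** The scales match because [L `^ walk_dim = M * rho]: the distance to the power
    [walk_dim], over the mass, scales like the energy. *)
Lemma dist_volume_bound (c : R) m (r v : R) : 0 < c ->
  c * L^-1 ^+ m <= r -> 0 < v -> v <= 2 * M%:R^-1 ^+ m ->
  c `^ dw * rho ^- m <= 2 * (r `^ dw / v).
Proof.
move=> c0 cr v0 vm; have L0 := ltW (ratio_gt0 nf).
have M0 := M_gt0 nf; have r0 := rho_gt0 hs.
have h : c `^ dw * (M%:R * rho) ^- m <= r `^ dw.
  rewrite -exprVn -ratio_powR_walk_dim -powR_exprn // -powRM ?(ltW c0) ?exprn_ge0 //.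
  rewrite ge0_ler_powR ?walk_dim_ge0 // nnegrE ?(le_trans _ cr) //.
    by rewrite mulr_ge0 ?exprn_ge0 ?(ltW c0).
  by rewrite mulr_ge0 ?exprn_ge0 ?(ltW c0).
rewrite mulrA ler_pdivlMr //.
apply: (@le_trans _ _ (c `^ dw * rho ^- m * (2 * M%:R^-1 ^+ m))).
  by rewrite ler_wpM2l // mulr_ge0 ?powR_ge0 // invr_ge0 exprn_ge0 // ltW.
suff -> : c `^ dw * rho ^- m * (2 * M%:R^-1 ^+ m) = 2 * (c `^ dw * (M%:R * rho) ^- m).
  by rewrite ler_pM2l.
by rewrite exprMn invfM exprVn; ring.
Qed.

End Volumes.

Theorem theorem3p4 (R : realType) (N M : nat)
    (phi : 'I_M -> 'rV[R]_N -> 'rV[R]_N) (L : R) (K : set 'rV[R]_N)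
    (a : 'rV[R]_N -> 'rV[R]_N -> R) (rho : R) :
  nested_fractal phi L K ->
  harmonic_structure phi a rho ->
  nondegenerate_structure phi K a rho ->
  property_P phi L K ->
  exists2 C : R, 0 < C &
    forall (mu nu : {measure set (borelE R N) -> \bar R})
      (n : nat) (e : 'I_n -> 'rV[R]_N -> R) (Z : borelE R N -> 'M[R]_n),
    normalized_hausdorff (dim_hausdorff M L) K mu ->
    orthonormal_basis phi K a rho e ->
    kusuoka_measure phi K a rho e nu ->
    is_Z phi K a rho e nu Z ->
    forall (f : 'rV[R]_N -> R) (gradf : borelE R N -> 'cV[R]_n),
    energy_domain phi K a rho f ->
    is_gradient phi K a rho e nu Z f gradf ->
    forall x y : 'rV[R]_N, (K `\` Vinf phi) x -> (K `\` Vinf phi) y -> x <> y ->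
    ((`|f x - f y| ^+ 2)%:E <=
     (C * eucl_dist x y `^ walk_dim M L rho)%:E
     * ((fine (mu (Sxy phi K x y)))^-1)%:E
     * \int[nu]_(z in Sxy phi K x y) (qform (Z z) (gradf z))%:E)%E.
Proof.
move=> nf hs nd hP.
have [C0 C00 osc] := oscillation_bound nf hs.
have [c c0 hc] := separated_dist nf hP.
have r0 := rho_gt0 hs.
have cd0 : 0 < c `^ walk_dim M L rho by rewrite powR_gt0.
(* 8 = 2 * 2 * 2: from [(s + t)^2 <= 2 s^2 + 2 t^2], from the two cells whose
   integrals are each at most that over their union, and from the mass of the
   union, at most twice that of a cell. *)
exists (8 * (C0 + 1) / c `^ walk_dim M L rho).
  by rewrite divr_gt0 // mulr_gt0 // ltr_wpDl.
move=> mu nu n e Z hmu he hnu hZ f gradf Df hg x y Kx Ky xy.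
have [w [w' [z [sw sw' [cx cy] [zw zw'] ->]]]] := ind_pred_cells nf Kx Ky xy.
have := hc _ _ Kx Ky xy; rewrite -sw => hd.
set S : set (borelE R N) := cell phi K w `|` cell phi K w'.
have mS : measurable S by apply: measurableU; exact: (cell_measurable nf).
have SK : S `<=` K by move=> t [|]; exact: (cell_sub nf).
have [A [mA A0 AV AZ]] := exceptional_set nf hnu hZ.
have Iw := integral_gradient_superset_ge nf hs nd he hmu hnu hZ mA A0 AV AZ Df hg mS.
have {Iw} [Iw Iw'] := (Iw w (@subsetUl _ _ _) SK, Iw w' (@subsetUr _ _ _) SK).
have muS : (mu S <= (2 * M%:R^-1 ^+ size w)%:E)%E.
  apply: le_trans (measureU2 _ (cell_measurable nf w) (cell_measurable nf w')) _.
  rewrite mulrDl mul1r EFinD; apply: leeD; first exact: (mu_cell_le nf hmu).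
  by rewrite -sw'; exact: (mu_cell_le nf hmu).
have muS0 : (0 < mu S)%E.
  apply: lt_le_trans (mu_cell_gt0 nf hmu w) _.
  by apply: le_measure; rewrite ?inE //; [exact: (cell_measurable nf)|left].
have [v vE] : exists v, mu S = v%:E.
  by exists (fine (mu S)); rewrite fineK // ge0_fin_numE ?(ltW muS0) // (le_lt_trans muS) ?ltry.
move: muS muS0; rewrite vE lee_fin lte_fin /= => muS muS0.
have := dist_volume_bound nf hs c0 hd muS0 muS.
set r := eucl_dist x y `^ _ => hv.
(* Inside one cell [f] is a rescaled function on the whole of [K]. *)
have inc u p q : cell phi K u p -> cell phi K u q ->
    (f p - f q) ^+ 2 <= C0 * energy phi a rho (f \o phi_w phi u) (f \o phi_w phi u).
  move=> [p' Kp <-] [q' Kq <-].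
  exact: (osc (f \o phi_w phi u) p' q' (energy_domain_comp nf hs u Df)).
have hxz := inc _ _ _ cx zw; have hzy := inc _ _ _ zw' cy.
have e0 u : 0 <= energy phi a rho (f \o phi_w phi u) (f \o phi_w phi u).
  exact/(energy_ge0 nf hs)/(energy_domain_comp nf hs).
set I := (\int[nu]_(z in S) _)%E in Iw Iw' *.
have rw0 : 0 < r / v.
  by apply: divr_gt0 => //; apply/powR_gt0/eucl_dist_gt0.
have Cc0 : 0 < 8 * (C0 + 1) / c `^ walk_dim M L rho.
  by rewrite divr_gt0 // mulr_gt0 // ltr_wpDl.
rewrite -EFinM -mulrA.
have I0 : (0 <= I)%E.
  apply: le_trans Iw; rewrite lee_fin; apply: mulr_ge0; last exact: e0.
  exact/exprn_ge0/ltW.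
case: I I0 Iw Iw' => [i||//].
  rewrite lee_fin => i0; rewrite lee_fin => Iw; rewrite lee_fin => Iw'.
  rewrite -(EFinM _ i) lee_fin.
  rewrite sw' in Iw'; set k := size w in hd muS hv Iw Iw' *.
  rewrite -ler_pdivlMl ?exprn_gt0 // in Iw; rewrite -ler_pdivlMl ?exprn_gt0 // in Iw'.
  rewrite real_normK ?num_real //.
  apply: (@le_trans _ _ (4 * C0 * (rho ^- k * i))).
    have := ler_wpM2l C00 Iw; have := ler_wpM2l C00 Iw'.
    have := sqr_ge0 ((f x - f z) - (f z - f y)).
    move: hxz hzy; nra.
  rewrite [leLHS]mulrA.
  suff : 4 * C0 * rho ^- k <= 8 * (C0 + 1) / c `^ walk_dim M L rho * (r / v).
    by move=> /(ler_wpM2r i0) /le_trans; apply; rewrite !mulrA.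
  rewrite [leRHS]mulrAC ler_pdivlMr //.
  have := ler_wpM2l C00 hv; move: rw0 cd0 hv; rewrite -/r.
  move: (r / v) (c `^ _) (rho ^- k) => q cd p q0 cd0' hv' h; lra.
move=> _ _ _; rewrite gt0_muley ?leey // lte_fin.
by have := mulr_gt0 Cc0 rw0; rewrite !mulrA.
Qed.
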